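(* Let $\mathbf{a}=(a_1,\dots,a_n)$ be a weak composition. Then the following are equivalent: (1) $\mathcal{P}(\mathbb{D}(\mathbf{a}))$ is pure and shellable; (2) $\mathcal{P}(\mathbb{D}(\mathbf{a}))$ is pure and EL-shellable; (3) $\mathbf{a}$ is a pure composition.
   Context: A diagram is a finite set of cells in $\mathbb{Z}_{>0}\times\mathbb{Z}_{>0}$; a cell $(r,c)$ lies in row $r$ (rows numbered from the bottom, starting at $1$) and column $c$. For a weak composition $\mathbf{a}=(a_1,\dots,a_n)$ (finite sequence of nonnegative integers), the key diagram is $\mathbb{D}(\mathbf{a})=\bigcup_{i=1}^n\{(i,j)\mid 1\le j\le a_i\}$. Applying a Kohnert move at row $r$ of a diagram $D$: if row $r$ is nonempty, let $(r,c)$ be its rightmost cell; if there is $r'$ with $1\le r'<r$ and $(r',c)\notin D$, take the largest such $r'$ and replace $(r,c)$ by $(r',c)$; otherwise $D$ is unchanged. The Kohnert poset $\mathcal{P}(D)$ is the set of diagrams obtainable from $D$ by finite (possibly empty) sequences of Kohnert moves, with $D_2\preceq D_1$ iff $D_2$ can be obtained from $D_1$ by a sequence of Kohnert moves. A weak composition $\mathbf{a}$ is pure if there are no indices $1\le j_1<j_2<j_3\le n$ with $a_{j_1}<a_{j_2}<a_{j_3}$, or $a_{j_1}<a_{j_3}<a_{j_2}$, or $a_{j_1}+1<a_{j_2}=a_{j_3}$. The order complex of a finite poset is the simplicial complex of its chains. A poset is pure if all its maximal chains have the same number of elements. A simplicial complex is shellable if its facets can be ordered $F_1,\dots,F_t$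 so that for each $2\le k\le t$ the complex $\left(\bigcup_{i<k}\overline{F_i}\right)\cap\overline{F_k}$ is pure of dimension $\dim F_k-1$ ($\overline F$ = all subsets of $F$, $\dim F=|F|-1$). A poset is shellable if its order complex is. A bounded poset (unique minimum and maximum) is EL-shellable if its covering pairs admit a labeling $\lambda$ by elements of some poset such that every interval $[x,y]$ has a unique saturated chain from $x$ to $y$ with weakly increasing labels, and its label sequence is lexicographically smaller than that of every other saturated chain from $x$ to $y$. *)

(* Defs.v *)
From HB Require Import structures.
From mathcomp Require Import all_boot all_order ssralg ssrint.
From mathcomp Require Import finmap boolp.

Set Implicit Arguments.
Unset Strict Implicit.
Unset Printing Implicit Defensive.

Import Order.TTheory.

(* A cell is a pair (row, column).  Rows and columns are numbered from 1, so   *)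
(* the diagrams of interest have no cell with a zero coordinate; this holds   *)
(* for key diagrams and is preserved by Kohnert moves.                        *)
Definition cell : Type := (nat * nat)%type.
Definition diagram : Type := {fset cell}.

(* A weak composition (a_1, ..., a_n) is a sequence of length n; a_i is        *)
(* nth 0 a i.-1.                                                              *)
Definition key_diagram (a : seq nat) : diagram :=
  [fset c in [seq (i, j) | i <- iota 1 (size a), j <- iota 1 (nth 0 a i.-1)]]%fset.

Definition row_end (r : nat) (D : diagram) : nat :=
  \max_(x <- enum_fset D | x.1 == r) x.2.

(* The default value 0 means that there is no free position, as rows are      *)
(* numbered from 1.                                                           *)
Definition landing_row (r c : nat) (D : diagram) : nat :=
  \max_(1 <= i < r | (i, c) \notin D) i.

Definition kohnert_move (r : nat) (D : diagram) : diagram :=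
  let c := row_end r D in
  let r' := landing_row r c D in
  if has (fun x : cell => x.1 == r) (enum_fset D) && (0 < r')
  then ((r', c) |` (D `\ (r, c)))%fset else D.

Definition kohnert_reach (D E : diagram) : Prop :=
  exists rs : seq nat, E = foldl (fun F r => kohnert_move r F) D rs.

Lemma kohnert_reach_refl D : kohnert_reach D D.
Proof. by exists [::]. Qed.

Lemma kohnert_reach_trans D E F :
  kohnert_reach D E -> kohnert_reach E F -> kohnert_reach D F.
Proof. by move=> [s ->] [t ->]; exists (s ++ t); rewrite foldl_cat. Qed.

Lemma landing_rowP r c D :
  0 < landing_row r c D -> landing_row r c D < r /\ (landing_row r c D, c) \notin D.
Proof.
rewrite /landing_row big_nat_cond.
apply: (big_ind (fun m => 0 < m -> m < r /\ (m, c) \notin D)) => //.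
- by move=> x y Hx Hy; rewrite /maxn; case: ifP.
- by move=> i /andP[/andP[_ ->] ->].
Qed.

Lemma row_end_in r D :
  has (fun x : cell => x.1 == r) (enum_fset D) -> (r, row_end r D) \in D.
Proof.
have H (s : seq cell) : has (fun x => x.1 == r) s ->
    (r, \max_(x <- s | x.1 == r) x.2) \in s.
  elim: s => //= x s IH; rewrite big_cons in_cons.
  case: eqP => [e _|_ /= /IH ->]; last by rewrite orbT.
  have ex : (r, x.2) = x by rewrite -e -surjective_pairing.
  have [hs|/hasPn hs] := boolP (has (fun y : cell => y.1 == r) s); last first.
    rewrite big_seq_cond big1 ?maxn0 ?ex ?eqxx // => y.
    by case/andP=> /hs/negP.
  by rewrite /maxn; case: ifP => _; rewrite ?(IH hs) ?orbT // ex eqxx.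
exact: H.
Qed.

Definition row_sum (D : diagram) : nat := \sum_(x <- enum_fset D) x.1.

Lemma kohnert_move_row_sum r D :
  kohnert_move r D = D \/ row_sum (kohnert_move r D) < row_sum D.
Proof.
rewrite /kohnert_move; case: ifP => [/andP[hr h0]|_]; last by left.
right; have [lt_r nin] := landing_rowP h0; have hin := row_end_in hr.
rewrite /row_sum (big_fsetD1 _ hin) /= big_fsetU1 /= ?ltn_add2r //.
by rewrite in_fsetD1 (negbTE nin) andbF.
Qed.

Lemma kohnert_reach_row_sum D E :
  kohnert_reach D E -> E = D \/ row_sum E < row_sum D.
Proof.
case=> s ->; elim: s D => [|r s IH] D /=; first by left.
have [->|lt1] := kohnert_move_row_sum r D; first exact: IH.
by right; have [->//|lt2] := IH (kohnert_move r D); apply: ltn_trans lt2 lt1.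
Qed.

Lemma kohnert_reach_anti D E :
  kohnert_reach D E -> kohnert_reach E D -> D = E.
Proof.
move=> /kohnert_reach_row_sum[->//|lt1] /kohnert_reach_row_sum[//|lt2].
by have := ltn_trans lt1 lt2; rewrite ltnn.
Qed.

Definition lower_hull (D : diagram) : diagram :=
  [fset c in [seq (i, x.2) | x <- enum_fset D, i <- iota 0 x.1.+1]]%fset.

Lemma in_lower_hull D (c : cell) :
  reflect (exists2 x, x \in D & (c.1 <= x.1) && (c.2 == x.2))
          (c \in lower_hull D).
Proof.
rewrite !inE; apply: (iffP allpairsPdep) => [[x [i [xD]]]|[x xD /andP[le1 /eqP e]]].
  by rewrite mem_iota /= => lei ->; exists x; rewrite //= eqxx andbT.
exists x, c.1; split=> //; first by rewrite mem_iota.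
by rewrite -e -surjective_pairing.
Qed.

Lemma kohnert_reach_lower_hull D E :
  kohnert_reach D E -> E \in fpowerset (lower_hull D).
Proof.
case=> s ->; rewrite fpowersetE.
have: (D `<=` lower_hull D)%fset.
  by apply/fsubsetP=> x xD; apply/in_lower_hull; exists x; rewrite ?leqnn ?eqxx.
elim: s {-2 4}D => [|r s IH] F //= sF; apply: IH; rewrite /kohnert_move.
case: ifP => // /andP[hr h0]; apply/fsubsetP=> x.
rewrite in_fset1U in_fsetD1 => /orP[/eqP ->|/andP[_]]; last exact: (fsubsetP sF).
have /(fsubsetP sF)/in_lower_hull[y yD /andP[/= le_y e]] := row_end_in hr.
apply/in_lower_hull; exists y; rewrite //= e andbT.
by apply: leq_trans le_y; have [/ltnW] := landing_rowP h0.
Qed.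

Record kohnert_poset (D : diagram) : Type := KohnertPoset {
  kdiag :> diagram;
  kdiagP : `[< kohnert_reach D kdiag >] }.

HB.instance Definition _ D := [isSub for @kdiag D].
HB.instance Definition _ D := [Choice of kohnert_poset D by <:].
HB.instance Definition _ D := [Countable of kohnert_poset D by <:].

Definition kposet_hull D (E : kohnert_poset D) : fpowerset (lower_hull D) :=
  FSetSub (kohnert_reach_lower_hull (asboolW (kdiagP E))).

Definition kposet_of_hull D (E : fpowerset (lower_hull D)) :
  option (kohnert_poset D) := insub (val E).

Lemma kposet_hullK D : pcancel (@kposet_hull D) (@kposet_of_hull D).
Proof. by move=> E; rewrite /kposet_of_hull /= valK. Qed.

HB.instance Definition _ D : isFinite (kohnert_poset D) :=
  PCanIsFinite (@kposet_hullK D).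

Definition kposet_le D (E2 E1 : kohnert_poset D) : bool :=
  `[< kohnert_reach E1 E2 >].

Lemma kposet_le_refl D : reflexive (@kposet_le D).
Proof. by move=> E; apply/asboolP/kohnert_reach_refl. Qed.

Lemma kposet_le_anti D : antisymmetric (@kposet_le D).
Proof.
move=> E F /andP[/asboolP h1 /asboolP h2].
by apply/val_inj/(kohnert_reach_anti h2 h1).
Qed.

Lemma kposet_le_trans D : transitive (@kposet_le D).
Proof.
move=> F E G /asboolP h1 /asboolP h2.
by apply/asboolP/(kohnert_reach_trans h2 h1).
Qed.

Fact kohnert_display : Order.disp_t. Proof. exact: Order.Disp tt tt. Qed.

HB.instance Definition _ D :=
  Order.Le_isPOrder.Build kohnert_display (kohnert_poset D)
    (@kposet_le_refl D) (@kposet_le_anti D) (@kposet_le_trans D).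

Definition pure_composition (a : seq nat) : Prop :=
  ~ exists j1 j2 j3, [/\ j1 < j2, j2 < j3, j3 < size a &
      let a1 := nth 0 a j1 in let a2 := nth 0 a j2 in let a3 := nth 0 a j3 in
      [\/ a1 < a2 < a3, a1 < a3 < a2 | (a1 + 1 < a2) && (a2 == a3)]].

(* A simplicial complex on V is represented by its set of faces, which        *)
(* includes the empty face.                                                   *)
Section Complexes.
Variable V : finType.
Implicit Types (F : {set V}) (K : {set {set V}}).

Definition dimension F : int := (#|F|%:Z - 1)%R.

Definition facets K : {set {set V}} := [set F | maxset [in K] F].

Definition pure_complex (K : {set {set V}}) (d : int) : Prop :=
  K != set0 /\ {in facets K, forall F, dimension F = d}.

Definition shellable_complex (K : {set {set V}}) : Prop :=
  exists Fs : seq {set V},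
    [/\ uniq Fs, Fs =i facets K &
        forall k, 0 < k < size Fs ->
          pure_complex
            ((\bigcup_(i < k) powerset (nth set0 Fs i))
               :&: powerset (nth set0 Fs k))
            (dimension (nth set0 Fs k) - 1)%R].

End Complexes.

Section FinitePosets.
Variables (d : Order.disp_t) (T : finPOrderType d).
Local Open Scope order_scope.

Definition is_chain (C : {set T}) : bool :=
  [forall x in C, forall y in C, x >=< y].

Definition order_complex : {set {set T}} := [set C | is_chain C].

Definition pure_poset : Prop :=
  forall C C' : {set T}, maxset is_chain C -> maxset is_chain C' -> #|C| = #|C'|.

Definition shellable_poset : Prop := shellable_complex order_complex.

Definition bounded_poset : Prop := exists b t : T, forall x : T, b <= x <= t.

Definition covered_by (x y : T) : bool :=
  (x < y) && [forall z, ~~ (x < z < y)].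

(* x :: s is a saturated chain from x to y.                                   *)
Definition saturated_chain (x y : T) (s : seq T) : bool :=
  path covered_by x s && (last x s == y).

Section Labeling.
Variables (dL : Order.disp_t) (L : porderType dL) (lam : T -> T -> L).

(* lam is only ever evaluated on covering pairs; the sequences of labels are  *)
(* compared lexicographically through the order of seqlexi.                   *)
Definition chain_labels (x : T) (s : seq T) : seqlexi L := pairmap lam x s.

Definition weakly_increasing (x : T) (s : seq T) : bool :=
  sorted <=%O (chain_labels x s).

Definition EL_labeling : Prop :=
  forall x y : T, x <= y ->
    exists s : seq T,
      [/\ saturated_chain x y s, weakly_increasing x s,
          forall s', saturated_chain x y s' -> weakly_increasing x s' -> s' = s &
          forall s', saturated_chain x y s' -> s' != s ->
            chain_labels x s < chain_labels x s'].

End Labeling.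

Definition EL_shellable : Prop :=
  bounded_poset /\
  exists (dL : Order.disp_t) (L : porderType dL) (lam : T -> T -> L),
    EL_labeling lam.

End FinitePosets.

Arguments pure_poset {d} T.
Arguments shellable_poset {d} T.
Arguments EL_shellable {d} T.

(* Main.v *)
(* Let [above E c t] be the number of cells of column c of E lying in rows > t.  Kohnert moves
   weakly decrease it, fix it at t = 0, and preserve [above E (c+1) t <= above E c t] for c >= 1.

   Suppose a is pure and E <= F pointwise among the diagrams with these properties.  In the
   rightmost column where E and F differ, some cell of F can drop by one row while F stays above
   E: a cell blocking it from the right would yield two rows longer than an earlier one in a way
   forbidden by purity.  Hence the poset consists of all such functions, ordered pointwise.
   Encode E by the triples (c, v, t) with v < above E c t; if E < F, the lexicographically least
   triple of F missing in E can be added to E.  Labelling a cover by the triple it adds therefore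
   gives an EL-labeling, and the lexicographic order of the maximal chains is a shelling.

   Conversely, sorting the rows of the key diagram by adjacent transpositions yields a maximal
   chain in which every step lowers one cell by one row, so a pure poset has only such covers.
   If a is not pure, transpositions that keep a forbidden pattern bring it to three consecutive
   rows, where a cell jumps over one that is blocked by a cell to its right; this jump is a cover
   that skips a rank. *)
Require Import Defs.
From mathcomp Require Import all_boot all_order.
From mathcomp Require Import ssralg ssrint finmap boolp zify.

Set Implicit Arguments.
Unset Strict Implicit.
Unset Printing Implicit Defensive.

Import Order.TTheory.

(** * Ranked posets *)

Section RankedPosets.
Variables (d : Order.disp_t) (T : finPOrderType d) (rho : T -> nat).
Local Open Scope order_scope.

Definition unit_cover (x y : T) : bool := (x < y) && (rho y == (rho x).+1).

Lemma unit_path_rank x s :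
  path unit_cover x s -> rho (last x s) = (rho x + size s)%N.
Proof.
by elim: s x => [|y s IH] x /=; rewrite ?addn0 // => /andP[/andP[_ /eqP e] /IH->]; lia.
Qed.

Lemma unit_path_lt x s : path unit_cover x s -> sorted <%O (x :: s).
Proof. by apply: sub_path => y z /andP[]. Qed.

Lemma unit_path_attains x s k :
    path unit_cover x s -> (rho x <= k <= rho (last x s))%N ->
  exists2 w, w \in x :: s & rho w = k.
Proof.
elim: s x => [|y s IH] x /=.
  by move=> _ h; exists x; rewrite ?mem_head //; lia.
move=> /andP[/andP[_ /eqP e] /IH{}IH] h.
have [->|ne] := eqVneq k (rho x); first by exists x; rewrite ?mem_head.
by have [|w wi <-] := IH; [lia|exists w; rewrite // in_cons wi orbT].
Qed.

Lemma lt_sorted_chain s : sorted <%O s -> is_chain [set x : T in s].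
Proof.
elim: s => [_|x s IH] /=.
  by apply/forall_inP => x; rewrite inE.
rewrite lt_path_sortedE => /andP[/allP lx /IH/forall_inP ch].
apply/forall_inP => y; rewrite !inE => /orP[/eqP->|ys]; apply/forall_inP => z.
  by rewrite !inE => /orP[/eqP->|/lx/lt_comparable//]; exact: comparablexx.
rewrite !inE => /orP[/eqP->|zs]; first by rewrite comparable_sym lt_comparable ?lx.
by apply: (forall_inP (ch y _)); rewrite inE.
Qed.

Hypothesis rho_lt : {homo rho : x y / x < y >-> (x < y)%N}.

Lemma comparable_rank_eq x y : x >=< y -> rho x = rho y -> x = y.
Proof. by case: comparableP => [/rho_lt|/rho_lt| |//] ; rewrite // => ? _; lia. Qed.

Lemma comparable_rank_lt x y : x >=< y -> (rho x < rho y)%N -> x < y.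
Proof. by case: comparableP => // [/rho_lt h|->] _; lia. Qed.

Lemma unit_cover_covered x y : unit_cover x y -> covered_by x y.
Proof.
case/andP => lxy /eqP e; rewrite /covered_by lxy; apply/forallP => z.
by apply/negP => /andP[/rho_lt ? /rho_lt]; lia.
Qed.

Variables bot top : T.
Hypothesis rho_bound : forall x, (rho bot <= rho x <= rho top)%N.

Lemma unit_path_maximal s :
  path unit_cover bot s -> last bot s = top -> maxset (@is_chain d T) [set x in bot :: s].
Proof.
move=> p l; apply/maxsetP; split; first exact/lt_sorted_chain/unit_path_lt.
move=> B chB sB; apply/eqP; rewrite eqEsubset sB andbT; apply/subsetP => x xB.
(* The path meets every rank from [rho bot] to [rho top], so some [w] on it has the rank of [x];
   comparable elements of equal rank coincide. *)
have [|w wi e] := @unit_path_attains bot s (rho x) p; first by rewrite l.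
rewrite inE; suff -> : x = w by [].
apply: comparable_rank_eq => //.
apply: (forall_inP (forall_inP chB _ xB)).
by apply: (subsetP sB); rewrite inE.
Qed.

Lemma card_unit_path s :
  path unit_cover bot s -> last bot s = top ->
  #|[set x in bot :: s]| = (rho top - rho bot).+1.
Proof.
move=> p l; rewrite cardsE.
have /card_uniqP-> /= : uniq (bot :: s).
  by have := unit_path_lt p; rewrite lt_sorted_uniq_le => /andP[].
by have := unit_path_rank p; rewrite l; lia.
Qed.

(* A maximal chain through a cover that skips a rank has fewer elements than one all of
   whose steps are unit. *)
Lemma pure_poset_unit_covers x y :
  pure_poset T -> connect unit_cover bot top -> covered_by x y ->
  rho y = (rho x).+1.
Proof.
move=> pT /connectP[s p l] /andP[lxy /forallP nz].
have [C mC sC] : {C : {set T} | maxset (@is_chain d T) C & [set x; y] \subset C}.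
  apply: maxset_exists; apply/forall_inP => a; rewrite !inE => ha.
  apply/forall_inP => b; rewrite !inE.
  by move: ha => /orP[]/eqP-> /orP[]/eqP->; rewrite ?comparablexx //;
     rewrite ?(lt_comparable lxy) // comparable_sym (lt_comparable lxy).
have chC := maxsetp mC.
have cardC := pT _ _ mC (unit_path_maximal p (esym l)).
rewrite (card_unit_path p (esym l)) in cardC.
have cmp u v : u \in C -> v \in C -> u >=< v.
  by move=> uC vC; apply: (forall_inP (forall_inP chC _ uC)).
have xC : x \in C by apply: (subsetP sC); rewrite !inE eqxx.
have yC : y \in C by apply: (subsetP sC); rewrite !inE eqxx orbT.
apply/eqP; rewrite eqn_leq (rho_lt lxy) andbT leqNgt; apply/negP => gap.
(* The ranks left for [C]: all from [rho bot] to [rho top] except the one skipped by the cover. An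
   element of [C] of that rank would be comparable to [x] and [y], hence strictly between them. *)
pose L := rem (rho x).+1 (iota (rho bot) (rho top - rho bot).+1).
have memL k : k \in L = (k != (rho x).+1) && (rho bot <= k <= rho top)%N.
  rewrite mem_rem_uniq ?iota_uniq // inE mem_iota; congr (_ && _).
  by have := rho_bound bot; lia.
have: (#|C| <= size L)%N.
  have <- : size [seq rho z | z <- enum C] = #|C| by rewrite size_map cardE.
  apply: uniq_leq_size.
    rewrite map_inj_in_uniq ?enum_uniq // => u v; rewrite !mem_enum => uC vC.
    by apply: comparable_rank_eq; apply: cmp.
  move=> k /mapP[z]; rewrite mem_enum => zC ->; rewrite memL rho_bound andbT.
  apply/negP => /eqP ez; have := nz z; case/negP; apply/andP; split.
    by apply: comparable_rank_lt; [exact: cmp|rewrite ez].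
  by apply: comparable_rank_lt; [exact: cmp|rewrite ez].
rewrite cardC size_rem ?size_iota ?ltnn // mem_iota.
by have := rho_bound x; have := rho_bound y; lia.
Qed.

End RankedPosets.

(** * Posets embedded in a Boolean lattice *)

Lemma dimension_setD1 (V : finType) (F : {set V}) x :
  x \in F -> dimension (F :\ x) = (dimension F - 1)%R.
Proof. by rewrite /dimension [in RHS](cardsD1 x) => ->; move: #|_| => n; lia. Qed.

Section SeqLexi.
Variables (d : Order.disp_t) (Q : orderType d).
Local Open Scope order_scope.
Implicit Types l : seqlexi Q.

(** The head of a sorted sequence is least among its entries; if the heads tie, the tails are again
    permutations of each other. *)
Lemma sorted_lexi_le l l' :
  sorted <=%O (l : seq Q) -> perm_eq (l : seq Q) l' -> l <= l'.
Proof.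
elim: l l' => [|a l IH] [|b l'] //; first by move=> _ /perm_size.
rewrite /= le_path_sortedE => /andP[/allP al sl] p.
have: b \in a :: l by rewrite (perm_mem p) mem_head.
rewrite lexi_cons inE => /predU1P[e|/al lab].
  by rewrite e lexx /= IH // -(perm_cons a) -[in X in perm_eq _ X]e.
rewrite (lab : a <= b) /=; apply/implyP => lba.
have e : b = a by apply/le_anti; rewrite lba (lab : a <= b).
by apply: IH; rewrite // -(perm_cons a) -[in X in perm_eq _ X]e.
Qed.

Lemma ltxi_cat2l (l l1 l2 : seq Q) :
  ((l ++ l1 : seqlexi Q) < l ++ l2) = ((l1 : seqlexi Q) < l2).
Proof. by elim: l => //= a l IH; rewrite eqhead_ltxiE. Qed.

End SeqLexi.

Section SetEmbedding.
Variables (d : Order.disp_t) (T : finPOrderType d).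
Variables (dQ : Order.disp_t) (Q : finOrderType dQ) (q0 : Q) (J : T -> {set Q}).
Local Open Scope order_scope.

Hypothesis J_le : forall x y, (x <= y) = (J x \subset J y).

Lemma J_inj : injective J.
Proof. by move=> x y e; apply/le_anti; rewrite !J_le e subxx. Qed.

Lemma J_card_lt x y : x < y -> (#|J x| < #|J y|)%N.
Proof.
rewrite lt_neqAle J_le => /andP[ne s]; apply: proper_card.
by rewrite properEneq s andbT; apply: contraNneq ne => /J_inj->.
Qed.

(** The key exchange property: the least element of [J y] missing from [J x] can be added to [J x]
    on its own, without leaving the interval from [x] to [y]. *)
Hypothesis J_step : forall x y, x < y -> exists q z,
  [/\ q \notin J x, J z = q |: J x, z <= y &
      forall q', q' \in J y -> q' \notin J x -> q <= q'].

(** On a cover, [J y] has exactly one element outside [J x], so the choice is forced; [q0] only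
    makes the label total. *)
Definition new_element (x y : T) : Q := odflt q0 [pick q in J y :\: J x].

Lemma J_add_covered x y q : q \notin J x -> J y = q |: J x -> covered_by x y.
Proof.
move=> nq e; apply: (unit_cover_covered (rho := fun x => #|J x|)); first exact: J_card_lt.
rewrite /unit_cover lt_neqAle J_le e subsetUr andbT cardsU1 nq eqxx andbT.
by apply: contraNneq nq => ->; rewrite e setU11.
Qed.

Lemma new_elementE x y q : q \notin J x -> J y = q |: J x -> new_element x y = q.
Proof.
move=> nq e; rewrite /new_element; case: pickP => [p|/(_ q)]; rewrite e !inE.
  by case: eqP => //= _ /andP[/negP].
by rewrite eqxx nq.
Qed.

(** The element [z] given by [J_step] satisfies [x < z <= y], so a cover forces [z = y]. *)
Lemma coveredP x y :
  covered_by x y -> new_element x y \notin J x /\ J y = new_element x y |: J x.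
Proof.
case/andP=> lxy /forallP nz; have [q [z [nq e lzy _]]] := J_step lxy.
have: ~~ (z < y) by have := nz z; case/andP: (J_add_covered nq e) => ->.
rewrite lt_neqAle lzy andbT negbK => /eqP ezy; subst z.
by rewrite (new_elementE nq e).
Qed.

Lemma covered_by_lt (x y : T) : covered_by x y -> x < y. Proof. by case/andP. Qed.

Lemma covered_by_unit x y : covered_by x y = unit_cover (fun x => #|J x|) x y.
Proof.
apply/idP/idP => [h|]; last exact/unit_cover_covered/J_card_lt.
by have [nq e] := coveredP h; rewrite /unit_cover covered_by_lt // e cardsU1 nq add1n eqxx.
Qed.

Local Notation labels := (@chain_labels d T dQ Q new_element).

Lemma mem_labels x s q : path (@covered_by _ T) x s ->
  (q \in J (last x s)) = (q \in J x) || (q \in (labels x s : seq Q)).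
Proof.
elim: s x => [|y s IH] x /=; first by rewrite orbF.
move=> /andP[/coveredP[_ e] /IH->]; rewrite e !inE; case: (q \in J x) => /=.
  by rewrite orbT.
by rewrite orbF.
Qed.

Lemma labels_notin x s q :
  path (@covered_by _ T) x s -> q \in (labels x s : seq Q) -> q \notin J x.
Proof.
elim: s x => [|y s IH] x //= /andP[/coveredP[nq e] /IH{}IH].
by rewrite inE => /predU1P[->//|/IH]; rewrite e !inE negb_or => /andP[].
Qed.

Lemma labels_uniq x s : path (@covered_by _ T) x s -> uniq (labels x s : seq Q).
Proof.
elim: s x => [|y s IH] x //= /andP[/coveredP[nq e] p].
rewrite IH // andbT; apply/negP => /(labels_notin p).
by rewrite e setU11.
Qed.

Lemma labels_inj x s s' :
  path (@covered_by _ T) x s -> path (@covered_by _ T) x s' ->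
  labels x s = labels x s' -> s = s'.
Proof.
elim: s x s' => [|y s IH] x [|y' s'] //= /andP[/coveredP[_ e] p] /andP[/coveredP[_ e'] p'].
case=> el eL; have ey : y = y' by apply: J_inj; rewrite e e' el.
by subst y'; congr cons; apply: IH p p' eL.
Qed.

(** Both sequences list the elements of [J (last x s)] outside [J x], each once. *)
Lemma perm_labels x s s' :
  path (@covered_by _ T) x s -> path (@covered_by _ T) x s' ->
  last x s = last x s' -> perm_eq (labels x s : seq Q) (labels x s').
Proof.
move=> p p' e; apply: uniq_perm; rewrite ?labels_uniq // => q.
have := mem_labels q p; rewrite e (mem_labels q p').
have := @labels_notin _ _ q p; have := @labels_notin _ _ q p'.
case: (q \in J x) => /=; last by move=> _ _ ->.
by do 2![case: (q \in _) => //]; do ?[move/(_ isT)] => //= _ /(_ isT).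
Qed.

(** Greedy construction: each step adds the least missing element. Every later label was already
    missing from [J x], so it is at least the first label. *)
Lemma increasing_chain x y : x <= y ->
  exists s, saturated_chain x y s /\ weakly_increasing new_element x s.
Proof.
have [n] := ubnP (#|J y| - #|J x|); elim: n x => // n IH x lt_n.
rewrite le_eqVlt => /predU1P[->|lxy]; first by exists [::]; rewrite /saturated_chain /= eqxx.
have [q [z [nq e lzy qmin]]] := J_step lxy.
have cxz := J_add_covered nq e.
have [|s [/andP[p /eqP l] w]] := IH z _ lzy.
  by have := J_card_lt lxy; rewrite e cardsU1 nq; lia.
exists (z :: s); split; first by rewrite /saturated_chain /= cxz p l eqxx.
rewrite /weakly_increasing /= le_path_sortedE (new_elementE nq e); apply/andP; split=> //.
apply/allP => q' qs; apply: qmin; first by rewrite -l (mem_labels _ p) qs orbT.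
by have := labels_notin p qs; rewrite e !inE negb_or => /andP[].
Qed.

(** All saturated chains of an interval carry the same labels up to order, and the labels determine
    the chain. Hence the sorted arrangement occurs only once and is lexicographically least. *)
Lemma new_element_EL : EL_labeling new_element.
Proof.
move=> x y /increasing_chain[s [sat w]]; have /andP[p /eqP l] := sat.
exists s; split=> // s' /andP[p' /eqP l'].
  move=> w'; apply: (labels_inj p' p); apply: le_sorted_eq w' w _.
  exact: perm_labels p' p (etrans l' (esym l)).
move=> ne; rewrite lt_neqAle; apply/andP; split.
  by apply: contra ne => /eqP h; rewrite (labels_inj p p').
by apply: sorted_lexi_le w _; exact: perm_labels p p' (etrans l (esym l')).
Qed.

(** The labels must descend somewhere to reach [q]. Up to the first descent they are at least the
    first label, hence above [q], so [q] has not yet been added at its middle element [w]. *)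
Lemma descent_above_label x z s q :
    path (@covered_by _ T) x (z :: s) -> q \in (labels x (z :: s) : seq Q) ->
    q < new_element x z ->
  exists s1 w u s2, [/\ z :: s = s1 ++ w :: u :: s2,
    new_element w u < new_element (last x s1) w & q \notin J w].
Proof.
elim: s x z => [|u s IH] x z.
  by move=> _ /=; rewrite inE => /eqP->; rewrite ltxx.
move=> p; have /= /andP[cxz p'] := p; rewrite inE => /predU1P[->|qs lq].
  by rewrite ltxx.
case: (ltP (new_element z u) (new_element x z)) => h.
  by exists [::], z, u, s; split=> //; exact: (labels_notin (s := u :: s) p' qs).
have [|s1 [w [u' [s2 [-> lw nw]]]]] := IH z u p' qs; first exact: lt_le_trans h.
by exists (z :: s1), w, u', s2.
Qed.

(** Where the chains first part, [s'] adds a label [q] smaller than that of [s]. From there on every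
    element of [s'] contains [q], whereas [s] has a descent at some [w] without [q]. *)
Lemma descent_outside x s s' :
    path (@covered_by _ T) x s -> path (@covered_by _ T) x s' -> last x s = last x s' ->
    labels x s' < labels x s ->
  exists s1 w u s2, [/\ s = s1 ++ w :: u :: s2, w \notin s' &
    new_element w u < new_element (last x s1) w].
Proof.
have subl y r : path (@covered_by _ T) y r -> path <%O y r.
  by apply: sub_path => ? ?; exact: covered_by_lt.
have mem_gt y r v : path (@covered_by _ T) y r -> v \in r -> y < v.
  by move=> /subl/(order_path_min lt_trans)/allP; apply.
elim: s x s' => [|z s IH] x [|z' s'] //.
  move=> p _ e _; have := mem_gt _ _ (last z s) p; rewrite mem_last.
  by move=> /(_ isT); rewrite [last z s]e ltxx.
move=> p p' e; have /= /andP[cz pz] := p; have /= /andP[cz' pz'] := p'.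
have [ez|ne] := eqVneq z z'.
  subst z'; rewrite /chain_labels /= eqhead_ltxiE.
  move=> /(IH z _ pz pz' e)[s1 [w [u [s2 [es nw lw]]]]].
  exists (z :: s1), w, u, s2; split=> //; first by rewrite es.
  rewrite inE negb_or nw andbT eq_sym; apply/eqP => ezw.
  have := mem_gt _ _ w pz; rewrite es mem_cat mem_head orbT ezw ltxx.
  by move/(_ isT).
have [nq eJ] := coveredP cz; have [nq' eJ'] := coveredP cz'.
have nl : new_element x z' != new_element x z.
  by apply: contraNneq ne => el; apply/eqP/J_inj; rewrite eJ eJ' el.
rewrite neqhead_ltxiE // => lq.
have [|s1 [w [u [s2 [es lw nw]]]]] := descent_above_label p _ lq.
  have := mem_labels (new_element x z') p; rewrite (negbTE nq') /= => <-.
  by rewrite [last z s]e; have := mem_labels (new_element x z') p'; rewrite /= mem_head orbT.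
exists s1, w, u, s2; split=> //; apply: contra nw; rewrite inE => /predU1P[->|wi].
  by rewrite eJ' setU11.
have /ltW := mem_gt _ _ _ pz' wi; rewrite J_le eJ' => /subsetP; apply.
exact: setU11.
Qed.

(** At a descent the two labels can be added in the opposite order: of the two elements in [J u]
    outside [J v], [J_step] adds the smaller one first. Only [w] changes. *)
Lemma descent_exchange x s1 w u s2 :
    path (@covered_by _ T) x (s1 ++ w :: u :: s2) ->
    new_element w u < new_element (last x s1) w ->
  exists2 w', path (@covered_by _ T) x (s1 ++ w' :: u :: s2) &
    labels x (s1 ++ w' :: u :: s2) < labels x (s1 ++ w :: u :: s2).
Proof.
rewrite cat_path /= => /and4P[p1 cw cu p2]; set v := last x s1 in cw * => lt_l.
have [nw ew] := coveredP cw; have [nu eu] := coveredP cu.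
have [q [w' [nq e lw' qmin]]] := J_step (lt_trans (covered_by_lt cw) (covered_by_lt cu)).
have nu' : new_element w u \notin J v by move: nu; rewrite ew !inE negb_or => /andP[].
have eq : q = new_element w u.
  have : q \in J u by move: lw'; rewrite J_le e => /subsetP; apply; apply: setU11.
  rewrite eu ew !inE (negbTE nq) orbF => /orP[/eqP//|/eqP eqw].
  have := qmin (new_element w u); rewrite eu setU11 eqw => /(_ isT nu').
  by rewrite leNgt lt_l.
subst q; have cw' := J_add_covered nq e.
have cu' : covered_by w' u.
  apply: (@J_add_covered _ _ (new_element v w)).
    by rewrite e !inE (negbTE nw) orbF; apply: contraTneq lt_l => ->; rewrite ltxx.
  by rewrite eu ew e setUCA.
exists w'; first by rewrite cat_path /= p1 cw' cu' p2.
rewrite /chain_labels !pairmap_cat ltxi_cat2l /= -/v (new_elementE nq e).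
by rewrite neqhead_ltxiE // (lt_eqF lt_l).
Qed.

(** * Maximal chains and their lexicographic shelling *)

Variables bot top : T.
Hypothesis bounds : forall x, bot <= x <= top.

Lemma rank_bound x : (#|J bot| <= #|J x| <= #|J top|)%N.
Proof. by have := bounds x; rewrite !J_le => /andP[/subset_leq_card-> /subset_leq_card->]. Qed.

Lemma saturated_unit_path (x y : T) s :
  saturated_chain x y s -> path (unit_cover (fun x => #|J x|)) x s /\ last x s = y.
Proof.
move=> /andP[p /eqP l]; split=> //.
by apply: sub_path p => u v; rewrite covered_by_unit.
Qed.

Lemma saturated_maximal s :
  saturated_chain bot top s -> maxset (@is_chain d T) [set x in bot :: s].
Proof.
by move=> /saturated_unit_path[p l]; apply: (unit_path_maximal J_card_lt rank_bound p l).
Qed.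

Lemma refine_chain (x : T) s y : path <%O x s -> last x s <= y ->
  exists2 s', saturated_chain x y s' & {subset s <= s'}.
Proof.
elim: s x => [|z s IH] x /=.
  by move=> _ /increasing_chain[s' [? _]]; exists s'.
move=> /andP[lxz p] /(IH _ p)[s2 /andP[p2 l2] sub2].
have [s1 [/andP[p1 /eqP l1] _]] := increasing_chain (ltW lxz).
exists (s1 ++ s2); first by rewrite /saturated_chain cat_path last_cat p1 l1 p2.
move=> u; rewrite inE mem_cat => /predU1P[->|/sub2->]; last by rewrite orbT.
suff -> : z \in s1 by [].
case: s1 p1 l1 => [|a s1] /= _ l1; first by rewrite l1 ltxx in lxz.
by rewrite -l1 mem_last.
Qed.

Lemma maximal_saturated C : maxset (@is_chain d T) C ->
  exists2 s, saturated_chain bot top s & C = [set x in bot :: s].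
Proof.
move=> mC; have /forall_inP chC := maxsetp mC.
pose c := sort <=%O (enum (C :\ bot)).
have memc x : x \in c = (x != bot) && (x \in C) by rewrite mem_sort mem_enum !inE.
have pc : path <%O bot c.
  rewrite lt_path_sortedE lt_sorted_uniq_le sort_uniq enum_uniq /=; apply/andP; split.
    apply/allP => x; rewrite memc => /andP[nx _].
    by rewrite lt_neqAle eq_sym nx; case/andP: (bounds x).
  apply: (@sort_sorted_in _ (mem C)) => [x y xC yC|].
    exact: (forall_inP (chC x xC) y yC).
  by apply/allP => x; rewrite mem_enum !inE => /andP[].
have [|s sat sub] := refine_chain pc (y := top).
  by case/andP: (bounds (last bot c)).
exists s => //; apply/esym/(maxsetsup mC); first exact: maxsetp (saturated_maximal sat).
apply/subsetP => x xC; rewrite !inE; have [//|ne] := eqVneq x bot.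
by rewrite sub // memc ne.
Qed.

Lemma embedding_pure : pure_poset T.
Proof.
move=> C C' /maximal_saturated[s /saturated_unit_path[p l] ->].
move=> /maximal_saturated[s' /saturated_unit_path[p' l'] ->].
by rewrite (card_unit_path p l) (card_unit_path p' l').
Qed.

Lemma embedding_EL_shellable : EL_shellable T.
Proof. by split; [exists bot, top|exists dQ, Q, new_element; apply: new_element_EL]. Qed.

(** The shelling order. Each step of a saturated chain adds one element to [J], so all of them
    appear among the tuples of this length. *)
Definition chain_list : seq (seq T) :=
  sort (relpre (labels bot) <=%O)
    [seq s <- map val (enum {: (#|J top| - #|J bot|).-tuple T}) | saturated_chain bot top s].

Lemma mem_chain_list s : (s \in chain_list) = saturated_chain bot top s.
Proof.
rewrite mem_sort mem_filter; apply/andP/idP => [[] //|sat]; split=> //.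
have sz : size s == (#|J top| - #|J bot|)%N.
  have [p l] := saturated_unit_path sat; have := unit_path_rank p.
  by rewrite l => ->; rewrite addKn.
by apply/mapP; exists (Tuple sz); rewrite ?mem_enum.
Qed.

Lemma chain_list_uniq : uniq chain_list.
Proof. by rewrite sort_uniq filter_uniq // map_inj_uniq ?enum_uniq //; exact: val_inj. Qed.

(** If [si] precedes [sk], then [sk] has a descent at some [w] outside [si]. Exchanging [w] gives an
    earlier chain that contains the rest of [sk], so every common face lies in a common face of
    codimension one. *)
Lemma embedding_shellable : shellable_poset T.
Proof.
pose facet (s : seq T) := [set x in bot :: s].
exists (map facet chain_list).
have facet_lt s : saturated_chain bot top s -> sorted <%O (bot :: s).
  by move=> /saturated_unit_path[p _]; apply: unit_path_lt p.
have facet_inj : {in chain_list &, injective facet}.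
  move=> s s'; rewrite !mem_chain_list => sat sat' e.
  suff [] : bot :: s = bot :: s' by [].
  apply: lt_sorted_eq; rewrite ?facet_lt // => x.
  by have /setP/(_ x) := e; rewrite !inE.
have facetE F : (F \in facets (order_complex T)) = maxset (@is_chain d T) F.
  by rewrite inE; apply: maxset_eq => C; rewrite inE.
split; first by rewrite map_inj_in_uniq ?chain_list_uniq.
  move=> F; rewrite facetE; apply/mapP/idP => [[s]|/maximal_saturated[s sat ->]].
    by rewrite mem_chain_list => /saturated_maximal ? ->.
  by exists s; rewrite ?mem_chain_list.
have tot : total (relpre (labels bot) <=%O) by move=> ? ?; exact: le_total.
have srt : sorted (relpre (labels bot) <=%O) chain_list by apply: sort_sorted.
have trn : transitive (relpre (labels bot) <=%O) by move=> ? ? ?; exact: le_trans.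
have rfl : reflexive (relpre (labels bot) <=%O) by move=> ?; exact: lexx.
rewrite size_map => k /andP[k0 ltk].
rewrite (nth_map [::]) //; set sk := nth [::] chain_list k.
have satk : saturated_chain bot top sk by rewrite -mem_chain_list mem_nth.
have /andP[pk /eqP lk] := satk.
set K := _ :&: _.
have inK (G : {set T}) : reflect (exists i, [/\ (i < k)%N, G \subset facet (nth [::] chain_list i) &
    G \subset facet sk]) (G \in K).
  rewrite inE powersetE; apply: (iffP andP) => [[/bigcupP[i _]]|[i [lti Gi Gk]]].
    by rewrite (nth_map [::]) ?powersetE ?(ltn_trans (ltn_ord i)) // => Gi Gk; exists i.
  split=> //; apply/bigcupP; exists (Ordinal lti); rewrite //= powersetE.
  by rewrite (nth_map [::]) // (ltn_trans lti).
split; first by apply/set0Pn; exists set0; apply/inK; exists 0; rewrite !sub0set.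
move=> G; rewrite inE => mG; have /inK[i [lti Gi Gk]] := maxsetp mG.
have lti' := ltn_trans lti ltk.
set si := nth _ _ i in Gi; have sati : saturated_chain bot top si.
  by rewrite -mem_chain_list mem_nth.
have /andP[pi /eqP li] := sati.
have lt_ik : labels bot si < labels bot sk.
  have := sorted_leq_nth trn rfl [::] srt i k lti' ltk (ltnW lti); rewrite /= lt_neqAle => ->.
  rewrite andbT.
  apply/eqP => /(labels_inj pi pk)/eqP; rewrite nth_uniq ?chain_list_uniq //.
  by rewrite (ltn_eqF lti).
have [s1 [w [u [s2 [ek nw lw]]]]] := descent_outside pk pi (etrans lk (esym li)) lt_ik.
rewrite ek in pk; have [w' pw' ltw'] := descent_exchange pk lw.
set s' := s1 ++ w' :: u :: s2 in pw' ltw'.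
have sat' : saturated_chain bot top s'.
  by rewrite /saturated_chain pw' -lk ek /s' !last_cat /= eqxx.
have wk : w \in facet sk by rewrite !inE ek mem_cat mem_head !orbT.
have nwb : w != bot.
  have := facet_lt _ satk; rewrite ek /= => /(order_path_min lt_trans)/allP/(_ w).
  by rewrite mem_cat mem_head orbT => /(_ isT)/gt_eqF->.
have sub' : facet sk :\ w \subset facet s'.
  apply/subsetP => x; rewrite !inE ek /s' !mem_cat !inE.
  by case: (x == w) => //= /or4P[]->; rewrite ?orbT.
have lt' : (index s' chain_list < size chain_list)%N by rewrite index_mem mem_chain_list.
have nth' : nth [::] chain_list (index s' chain_list) = s' by rewrite nth_index ?mem_chain_list.
have lt'k : (index s' chain_list < k)%N.
  rewrite ltnNge; apply/negP => /(sorted_leq_nth trn rfl [::] srt k _ ltk lt').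
  by rewrite nth' /= leNgt -/sk ek ltw'.
have DK : facet sk :\ w \in K.
  by apply/inK; exists (index s' chain_list); rewrite nth' sub' subD1set lt'k.
(* [G] avoids [w] because it lies in the facet of [si]; as [facet sk :\ w] belongs to [K],
   maximality of [G] gives equality. *)
have -> : G = facet sk :\ w.
  apply/esym/(maxsetsup mG) => //; rewrite subsetD1 Gk; apply/negP => wG.
  by have := subsetP Gi w wG; rewrite !inE (negbTE nwb) (negbTE nw).
exact: dimension_setD1.
Qed.

End SetEmbedding.

(** * Column counts of diagrams *)

Definition above (D : diagram) (c t : nat) : nat :=
  \sum_(x <- enum_fset D) ((t < x.1) && (x.2 == c)).

Lemma aboveS D c t : above D c t = above D c t.+1 + ((t.+1, c) \in D).
Proof.
have -> : ((t.+1, c) \in D : nat) = \sum_(x <- enum_fset D) (x == (t.+1, c)).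
  by rewrite -(count_uniq_mem _ (fset_uniq D)) -sum1_count big_mkcond.
rewrite -big_split; apply: eq_bigr => -[i j] _ /=; rewrite xpair_eqE.
by case: (j == c); case: (ltngtP i t.+1); rewrite ?andbF ?andbT //; lia.
Qed.

Lemma above_pos D c t : 0 < above D c t -> exists2 x, x \in D & (t < x.1) && (x.2 == c).
Proof.
move=> h; apply/hasP; apply: contraTT h => /hasPn h.
by rewrite /above big_seq big1 // => x /h/negbTE->.
Qed.

Lemma above_gt0 D c t r : (r, c) \in D -> t < r -> 0 < above D c t.
Proof. by move=> rD lt; rewrite /above (big_fsetD1 _ rD) /= lt eqxx. Qed.

Lemma above_gt1 D c t l :
  1 < above D c t -> exists i, [/\ i != l, t < i & (i, c) \in D].
Proof.
have [lD|lD] := boolP ((l, c) \in D); last first.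
  move=> h; have [|[i j] iD /= /andP[lti /eqP e]] := @above_pos D c t; first by lia.
  by subst j; exists i; split=> //; apply: contraNneq lD => <-.
rewrite /above (big_fsetD1 _ lD) /= => h.
have [|[i j]] := @above_pos (D `\ (l, c))%fset c t.
  by rewrite /above; move: h; case: (_ && _) => /=; rewrite ?add0n ?add1n // => /ltnW.
rewrite in_fsetD1 xpair_eqE => /andP[ne iD] /= /andP[lti /eqP e]; subst j.
by exists i; split=> //; move: ne; rewrite eqxx andbT.
Qed.

Lemma above_leD D c t k : above D c t <= above D c (t + k) + k.
Proof.
elim: k t => [|k IH] t; first by rewrite !addn0.
by rewrite aboveS (addnS t) -addSn; have := IH t.+1; case: (_ \in _); lia.
Qed.

Lemma above_full D c t k :
  (forall i, t < i <= t + k -> (i, c) \in D) -> above D c t = above D c (t + k) + k.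
Proof.
elim: k t => [|k IH] t full; first by rewrite !addn0.
have -> : above D c t = (above D c t.+1).+1 by rewrite aboveS full ?addn1 //; lia.
have := IH t.+1; rewrite addSnnS => -> => [|i /andP[lt_i le_i]]; first by rewrite [RHS]addnS.
by apply: full; rewrite (ltnW lt_i).
Qed.

Lemma above_notfull D c t : above D c 0 < above D c t + t -> exists i, 0 < i <= t /\ (i, c) \notin D.
Proof.
move=> h; apply/not_existsP => full.
have e := @above_full D c 0 t; rewrite add0n in e.
rewrite e ?ltnn // in h => i hi; apply/negPn/negP => ni; exact: (full i).
Qed.

(** Consecutive differences of the counts recover all cells in positive rows. *)
Lemma above_inj E F :
    (forall x, x \in E -> 0 < x.1) -> (forall x, x \in F -> 0 < x.1) ->
    (forall c t, above E c t = above F c t) -> E = F.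
Proof.
move=> pE pF e; apply/fsetP => -[[|i] c]; first by apply/idP/idP => [/pE|/pF].
by have := e c i; rewrite (aboveS E) (aboveS F) e => /addnI; do 2!case: (_ \in _).
Qed.

(** * Kohnert moves as drops of one cell *)

Definition move_cell (D : diagram) r c r' : diagram := ((r', c) |` (D `\ (r, c)))%fset.

Lemma in_move_cell D r c r' x :
  (x \in move_cell D r c r') = (x == (r', c)) || (x != (r, c)) && (x \in D).
Proof. by rewrite in_fset1U in_fsetD1. Qed.

Lemma above_move_cell D r c r' c0 t : (r, c) \in D -> (r', c) \notin D ->
  above (move_cell D r c r') c0 t + ((t < r) && (c == c0)) =
  above D c0 t + ((t < r') && (c == c0)).
Proof.
move=> rD r'D; rewrite /above (big_fsetD1 _ rD) /move_cell big_fsetU1 /=; first lia.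
by rewrite in_fsetD1 (negbTE r'D) andbF.
Qed.

(** An effective Kohnert move at row [r] in relational form, free of the maxima and their default 0:
    [c] is the end of the row and [r'] is the first free row below. *)
Definition drops (D : diagram) r c r' : Prop :=
  [/\ (r, c) \in D, forall c', (r, c') \in D -> c' <= c, 0 < r' < r,
      (r', c) \notin D & forall i, r' < i < r -> (i, c) \in D].

Lemma row_end_max D r c : (r, c) \in D -> c <= row_end r D.
Proof. by move=> rD; apply: (@leq_bigmax_seq _ _ _ snd (r, c)) => /=. Qed.

Lemma landing_row_full D r c i : landing_row r c D < i < r -> (i, c) \in D.
Proof.
move=> h; apply/negPn/negP => ni; have : i <= landing_row r c D.
  by apply: (@leq_bigmax_seq _ _ _ id i) => //; rewrite mem_index_iota; lia.
lia.
Qed.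

Lemma kohnert_moveP r D :
  kohnert_move r D = D \/
  exists c r', drops D r c r' /\ kohnert_move r D = move_cell D r c r'.
Proof.
rewrite /kohnert_move; case: ifP => [/andP[hr h0]|_]; last by left.
right; exists (row_end r D), (landing_row r (row_end r D) D); split=> //.
have [lt_r nin] := landing_rowP h0; split=> //; last exact: landing_row_full.
- exact: row_end_in.
- by move=> c' /row_end_max.
- by rewrite h0.
Qed.

Lemma drops_kohnert_move D r c r' : drops D r c r' -> kohnert_move r D = move_cell D r c r'.
Proof.
case=> rD rmax /andP[r'0 r'r] r'D full.
have hr : has (fun x : cell => x.1 == r) (enum_fset D) by apply/hasP; exists (r, c) => /=.
have ec : row_end r D = c.
  by apply/eqP; rewrite eqn_leq row_end_max // andbT; apply/rmax/row_end_in.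
have le' : r' <= landing_row r c D.
  by apply: (@leq_bigmax_seq _ _ _ id r') => //; rewrite mem_index_iota r'0.
have el : landing_row r c D = r'.
  have [|lt_l nl] := @landing_rowP r c D; first exact: leq_trans le'.
  apply/eqP; rewrite eqn_leq le' andbT leqNgt; apply/negP => lt'.
  by rewrite full ?lt' in nl.
by rewrite /kohnert_move ec el hr r'0.
Qed.

Lemma reach_ind (P : diagram -> Prop) D E :
  (forall F r, P F -> P (kohnert_move r F)) -> P D -> kohnert_reach D E -> P E.
Proof. by move=> h PD [s ->]; elim: s D PD => //= r s IH D /(h D r)/IH. Qed.

Lemma reach_first_move D E : kohnert_reach D E ->
  E = D \/ exists r c r', drops D r c r' /\ kohnert_reach (move_cell D r c r') E.
Proof.
case=> s; elim: s => [|r s IH] /= in D *; first by left.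
have [->//|[c [r' [dr ->]]] eE] := kohnert_moveP r D; first exact: IH.
by right; exists r, c, r'; split=> //; exists s.
Qed.

Lemma drops_reach D r c r' : drops D r c r' -> kohnert_reach D (move_cell D r c r').
Proof. by move/drops_kohnert_move <-; exists [:: r]. Qed.

Lemma above_drop_le D r c r' c0 t : drops D r c r' -> above (move_cell D r c r') c0 t <= above D c0 t.
Proof.
case=> rD _ /andP[_ ltr] r'D _; have := above_move_cell c0 t rD r'D.
by case: (c == c0); rewrite ?andbT ?andbF; lia.
Qed.

Lemma above_reach D E c t : kohnert_reach D E -> above E c t <= above D c t.
Proof.
apply: (reach_ind (P := fun F => above F c t <= above D c t)) => // F r le.
have [->//|[c' [r' [dr ->]]]] := kohnert_moveP r F.
exact: leq_trans (above_drop_le _ _ dr) le.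
Qed.

(** * Key diagrams and the invariants of reachable diagrams *)

Lemma in_key a i j : ((i, j) \in key_diagram a) = (0 < i) && (0 < j <= nth 0 a i.-1).
Proof.
rewrite !inE; apply/allpairsPdep/idP => [[x [y [+ + [-> ->]]]]|/andP[i0 /andP[j0 jle]]].
  by rewrite !mem_iota => /andP[-> _] /andP[-> h]; rewrite -ltnS.
exists i, j; split; rewrite // mem_iota ?i0 ?j0 add1n ltnS //=.
by case: (leqP i (size a)) => // h; move: jle; rewrite nth_default; lia.
Qed.

Lemma key_row_gt0 a x : x \in key_diagram a -> 0 < x.1.
Proof. by case: x => i j; rewrite in_key => /andP[]. Qed.

Lemma above_key_col a c t : 0 < c -> above (key_diagram a) c.+1 t <= above (key_diagram a) c t.
Proof.
move=> c0; have [n] := ubnP (size a - t); elim: n t => // n IH t lt_n.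
have [le|lt] := leqP (size a) t.
  suff -> : above (key_diagram a) c.+1 t = 0 by [].
  apply/eqP; rewrite -leqn0 leqNgt; apply/negP => /above_pos[[i j] + /= /andP[lti _]].
  by rewrite in_key nth_default ?andbF //; lia.
rewrite !(aboveS _ _ t) leq_add ?IH //; first by lia.
by rewrite !in_key /= c0 /=; case: (leqP c.+1 _) => // /ltnW->.
Qed.

(** Invariants of the diagrams reachable from the key diagram; for pure [a] they characterise these
    diagrams, by [pure_reach]. Columns are compared from 1 on because column 0 is empty. *)
Definition admissible (a : seq nat) (E : diagram) : Prop :=
  [/\ forall x, x \in E -> 0 < x.1,
      forall c, above E c 0 = above (key_diagram a) c 0,
      forall c t, above E c t <= above (key_diagram a) c t &
      forall c t, 0 < c -> above E c.+1 t <= above E c t].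

Lemma admissible_key a : admissible a (key_diagram a).
Proof. by split=> // [x /key_row_gt0|c t]; last exact: above_key_col. Qed.

Lemma admissible_col a E c c' t :
  admissible a E -> 0 < c -> c <= c' -> above E c' t <= above E c t.
Proof.
case=> _ _ _ col c0 /subnKC <-; elim: (c' - c) => [|k IH]; first by rewrite addn0.
by rewrite addnS (leq_trans _ IH) // col // addn_gt0 c0.
Qed.

Lemma admissible_inj a E F : admissible a E -> admissible a F ->
  (forall c t, above E c t = above F c t) -> E = F.
Proof. by case=> pE _ _ _ [pF _ _ _]; apply: above_inj. Qed.

(** In rows [t + 1] to [r], column [c] is full while column [c + 1] misses at least row [r], since
    [c] ends that row. This slack keeps the column inequality valid after the drop. *)
Lemma drops_gap a E r c r' t : admissible a E -> drops E r c r' ->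
  0 < c -> r' <= t < r -> above E c.+1 t < above E c t.
Proof.
move=> [_ _ _ col] [rE rmax /andP[r'0 ltr] r'E full] c0 /andP[le_t lt_t].
have fullt : above E c t = above E c r + (r - t).
  rewrite (@above_full _ _ t (r - t)) ?subnKC ?(ltnW lt_t) // => i /andP[lti].
  rewrite leq_eqVlt => /predU1P[->//|ltir]; apply: full; lia.
have rE' : (r, c.+1) \notin E by apply/negP => /rmax; rewrite ltnn.
have er : above E c.+1 r.-1 = above E c.+1 r.
  by rewrite aboveS prednK; [rewrite (negbTE rE') addn0|lia].
have := above_leD E c.+1 t (r.-1 - t); have := col c r c0.
by rewrite subnKC; lia.
Qed.

Lemma admissible_drop a E r c r' :
  admissible a E -> drops E r c r' -> admissible a (move_cell E r c r').
Proof.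
move=> adE dr; have [pE tot le col] := adE; have [rE _ /andP[r'0 ltr] r'E _] := dr.
split=> [[i j]|c0|c0 t|c0 t c00].
- rewrite in_move_cell => /predU1P[[-> _]//|/andP[_]]; exact: pE.
- have := above_move_cell c0 0 rE r'E; rewrite r'0 (ltn_trans r'0 ltr) => /addIn ->.
  exact: tot.
- exact: leq_trans (above_drop_le _ _ dr) (le _ _).
have := above_move_cell c0 t rE r'E; have := above_move_cell c0.+1 t rE r'E.
have := col c0 t c00; have gap := @drops_gap a E r c r' t adE dr.
case: (eqVneq c c0) => [e|ne].
  rewrite -e in c00 *; rewrite (ltn_eqF (ltnSn c)) !andbF !addn0.
  by have := gap c00; rewrite !andbT; lia.
by case: (c == _); rewrite ?andbF ?andbT; lia.
Qed.

Lemma reach_admissible a E : kohnert_reach (key_diagram a) E -> admissible a E.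
Proof.
apply: reach_ind (admissible_key a) => F r adF.
have [->//|[c [r' [dr ->]]]] := kohnert_moveP r F; exact: admissible_drop.
Qed.

(** * Pure compositions *)

(** Row [i] is shorter than [c], row [j] is not, and row [k] exceeds row [i] by at least two.
    Whichever of [j], [k] comes first, each comparison of their lengths gives one of the forbidden
    patterns. *)
Lemma pure_two_larger a i j k c c' :
    pure_composition a -> 0 < i -> i < j -> i < k -> j != k -> 0 < c < c' ->
    (i, c) \notin key_diagram a -> (j, c) \in key_diagram a -> (k, c') \in key_diagram a ->
  False.
Proof.
move=> pa i0 ij ik njk /andP[c0 cc']; rewrite !in_key i0 c0 /= -ltnNge.
move=> ai /andP[_ aj] /and3P[_ _ ak]; apply: pa.
have sz n : 0 < nth 0 a n -> n < size a.
  by case: (ltnP n (size a)) => // /(nth_default 0)->.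
have szj := sz j.-1; have szk := sz k.-1.
case: (ltngtP j k) njk => // jk _.
  exists i.-1, j.-1, k.-1; split; try lia.
  by case: (ltngtP (nth 0 a j.-1) (nth 0 a k.-1)) => /= h; [apply: Or31|apply: Or32|apply: Or33]; lia.
exists i.-1, k.-1, j.-1; split; try lia.
by case: (ltngtP (nth 0 a k.-1) (nth 0 a j.-1)) => /= h; [apply: Or31|apply: Or32|apply: Or33]; lia.
Qed.

(** Going down from a cell of [F], the excess of [F] over [E] persists as long as the cells of [F]
    are contiguous. It vanishes at level 0, so a hole comes first. *)
Lemma hole_below E F c t :
    above E c 0 = above F c 0 -> above E c t < above F c t -> (t.+1, c) \in F ->
  exists r, [/\ 0 < r, above E c r < above F c r, (r.+1, c) \in F & (r, c) \notin F].
Proof.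
move=> e0; elim: t => [|t IH] lt tF; first by rewrite e0 ltnn in lt.
have [t1F|nt1] := boolP ((t.+1, c) \in F); last by exists t.+1.
by apply: (IH _ t1F); rewrite (aboveS E) (aboveS F) t1F; case: (_ \in _); lia.
Qed.

(** At the highest level with an excess, the excess must come from a cell of [F] in the next row. *)
Lemma cell_above E F c t : above E c t < above F c t ->
  exists2 r, above E c r < above F c r & (r.+1, c) \in F.
Proof.
move=> lt.
have bound k : above E c k < above F c k -> k <= \max_(x <- enum_fset F) x.1.
  move=> h; have [|x xF /andP[lt_k _]] := @above_pos F c k; first by lia.
  by rewrite (leq_trans (ltnW lt_k)) // (@leq_bigmax_seq _ _ _ fst x).
have ex : exists k, above E c k < above F c k by exists t.
case: (ex_maxnP ex bound) => k lt_k max_k; exists k => //.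
have := max_k k.+1; rewrite ltnn leqNgt; have := aboveS F c k; have := aboveS E c k.
by case: (_ \in F); case: (_ \in E); lia.
Qed.

Lemma unit_drop_toward a E F :
    pure_composition a -> admissible a E -> admissible a F ->
    (forall c t, above E c t <= above F c t) -> E <> F ->
  exists r c, drops F r.+1 c r /\
    forall c' t, above E c' t <= above (move_cell F r.+1 c r) c' t.
Proof.
move=> pa adE adF le ne; have [_ totE leE _] := adE; have [pF totF leF _] := adF.
have ex : exists c, `[< exists t, above E c t < above F c t >].
  apply: contra_notP ne => nex; apply: (admissible_inj adE adF) => c t.
  apply/eqP; rewrite eqn_leq le leqNgt; apply/negP => lt; apply: nex.
  by exists c; apply/asboolP; exists t.
have bound c : `[< exists t, above E c t < above F c t >] ->
    c <= \max_(x <- enum_fset F) x.2.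
  move=> /asboolP[t h]; have [|x xF /andP[_ /eqP <-]] := @above_pos F c t; first by lia.
  exact: (@leq_bigmax_seq _ _ _ snd x).
case: (ex_maxnP ex bound) => c /asboolP[t0 /cell_above[t lt_t tF]] max_c.
have [|r [r0 lt_r rF nrF]] := hole_below _ lt_t tF; first by rewrite totE totF.
have eqc c' k : c < c' -> above E c' k = above F c' k.
  move=> cc'; apply/eqP; rewrite eqn_leq le leqNgt; apply/negP => lt.
  by have := max_c c'; rewrite leqNgt cc' => h; have := h (asboolT (ex_intro _ k lt)).
have c0 : 0 < c.
  case: posnP => // c0; subst c; have le0 := leF 0 r; have [|[i j]] := @above_pos (key_diagram a) 0 r.
    by lia.
  by rewrite in_key => /and3P[_ j0 _] /= /andP[_ /eqP jE]; rewrite jE in j0.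
exists r, c; split; last first.
  move=> c' k; have := above_move_cell c' k rF nrF; have := le c' k.
  case: eqVneq => [<-|_]; last by rewrite !andbF; lia.
  by rewrite !andbT; case: (ltngtP k r) => [h|h|->]; lia.
split=> //; [|by lia|by move=> i; lia].
(* Suppose a cell in column [c' > c] blocks the drop. [E] and [F] agree in column [c'], so [E] has a
   cell of column [c] above row [r], and [F] has at least two. The key diagram then has two rows
   [i], [l] above [r], reaching columns [c] and [c']. *)
move=> c' rF'; rewrite leqNgt; apply/negP => cc'.
have gF' := above_gt0 rF' (ltnSn r).
have le1 := admissible_col r adE c0 (ltnW cc'); rewrite (eqc _ r cc') in le1.
have gt1 : 1 < above (key_diagram a) c r by apply: leq_trans (leF c r); lia.
have [|[l j] lD /= /andP[rl /eqP ej]] := @above_pos (key_diagram a) c' r.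
  by apply: leq_trans (leF c' r).
subst j; have [i [nil ri iD]] := above_gt1 l gt1.
(* [F] misses [(r, c)], has the column total of the key diagram and no more cells above row [r]; so
   the key diagram also has a hole in column [c] at or below row [r]. *)
have [|h [/andP[h0 hr] hD]] := @above_notfull (key_diagram a) c r.
  have := @above_leD F c 0 r.-1; rewrite add0n totF.
  have := aboveS F c r.-1; rewrite prednK // (negbTE nrF) addn0 => ->.
  by have := leF c r; lia.
by apply: (@pure_two_larger a h i l c c'); rewrite ?c0 //; lia.
Qed.

Lemma move_cell_row_sum D r c r' : drops D r c r' -> row_sum (move_cell D r c r') < row_sum D.
Proof.
move=> dr; rewrite -(drops_kohnert_move dr).
have [e|//] := kohnert_move_row_sum r D; have [rD _ _ r'D _] := dr.
by case/negP: r'D; rewrite -e (drops_kohnert_move dr) in_move_cell eqxx.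
Qed.

Lemma pure_reach a E F :
    pure_composition a -> admissible a E -> admissible a F ->
    (forall c t, above E c t <= above F c t) ->
  kohnert_reach F E.
Proof.
move=> pa adE; have [n] := ubnP (row_sum F); elim: n F => // n IH F lt_n adF le.
have [->|ne] := EM (E = F); first exact: kohnert_reach_refl.
have [r [c [dr le']]] := unit_drop_toward pa adE adF le ne.
apply: kohnert_reach_trans (drops_reach dr) _.
apply: IH le'; last exact: admissible_drop dr.
by have := move_cell_row_sum dr; lia.
Qed.

(** * Encoding of counts by sets of triples *)

Section Encoding.
Variable a : seq nat.

Definition bound : nat := (size a + sumn a).+1.

Local Notation triple := ('I_bound *l ('I_bound *l 'I_bound))%type.

Definition triple0 : triple := (ord0, (ord0, ord0)).

(** Inclusion of encodings is the pointwise order of the counts. Triples are compared by column,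
    then value, then level; [unit_raise] relies on this order of the coordinates. *)
Definition encoding (E : diagram) : {set triple} :=
  [set q : triple | q.2.1 < above E q.1 q.2.2].

Lemma key_bound i j : (i, j) \in key_diagram a -> (i <= size a) && (j <= sumn a).
Proof.
rewrite in_key => /and3P[i0 j0 le].
have lti : i.-1 < size a.
  by rewrite ltnNge; apply/negP => /(nth_default 0) e; rewrite e in le; lia.
apply/andP; split; first lia.
rewrite (leq_trans le) // sumnE (big_nth 0) big_mkord.
by rewrite (bigD1 (Ordinal lti)) //= leq_addr.
Qed.

Lemma admissible_bound E c v t :
  admissible a E -> v < above E c t -> [/\ c < bound, v < bound & t < bound].
Proof.
case=> _ _ le _ lt; rewrite /bound.
have le1 := le c t; have [|[i j] + /= /andP[lti /eqP e]] := @above_pos (key_diagram a) c t.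
  by lia.
rewrite {j}e => /key_bound/andP[lei lec]; split; try lia.
suff e : above (key_diagram a) c (t + size a) = 0.
  by have := above_leD (key_diagram a) c t (size a); have := le c t; lia.
apply/eqP; rewrite -leqn0 leqNgt; apply/negP => /above_pos[[i' j] /key_bound/=].
by move=> /andP[? _] /andP[? _]; lia.
Qed.

Lemma encoding_sub E F : admissible a E ->
  reflect (forall c t, above E c t <= above F c t) (encoding E \subset encoding F).
Proof.
move=> adE; apply: (iffP subsetP) => [sub c t|le [c [v t]]]; last first.
  by rewrite !inE /= => /leq_trans; apply.
case e: (above E c t) => [//|v]; have lt : v < above E c t by rewrite e.
have [hc hv ht] := admissible_bound adE lt.
by have := sub (Ordinal hc, (Ordinal hv, Ordinal ht)); rewrite !inE; apply.
Qed.

End Encoding.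

(** * The Kohnert poset of a pure composition *)

Lemma kposet_leP D (x y : kohnert_poset D) : reflect (kohnert_reach y x) (x <= y)%O.
Proof. exact: asboolP. Qed.

Lemma kposet_reach D (x : kohnert_poset D) : kohnert_reach D x.
Proof. exact: asboolW (kdiagP x). Qed.

Definition kposet_elt D E (h : kohnert_reach D E) : kohnert_poset D := KohnertPoset (asboolT h).

Lemma kposet_admissible a (x : kohnert_poset (key_diagram a)) : admissible a x.
Proof. exact/reach_admissible/kposet_reach. Qed.

Lemma kposet_le_encoding a (x y : kohnert_poset (key_diagram a)) :
  (x <= y)%O -> encoding a x \subset encoding a y.
Proof.
move=> /kposet_leP h; apply/encoding_sub; first exact: kposet_admissible.
by move=> c t; apply: above_reach.
Qed.

Lemma kposet_encoding_inj a :
  injective (fun x : kohnert_poset (key_diagram a) => encoding a x).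
Proof.
move=> x y e; apply/val_inj/admissible_inj; try exact: kposet_admissible.
move=> c t; apply/eqP; rewrite eqn_leq.
have /(encoding_sub y (kposet_admissible x)) -> : encoding a x \subset encoding a y by rewrite e.
have /(encoding_sub x (kposet_admissible y)) -> // : encoding a y \subset encoding a x by rewrite e.
Qed.

Lemma kposet_encoding_lt a :
  {homo (fun x : kohnert_poset (key_diagram a) => #|encoding a x|) : x y / (x < y)%O >-> x < y}.
Proof.
move=> x y; rewrite lt_neqAle => /andP[ne /kposet_le_encoding s]; apply: proper_card.
rewrite properEneq s andbT; apply: contraNneq ne => e; exact/eqP/kposet_encoding_inj.
Qed.

Lemma pure_le_encoding a (x y : kohnert_poset (key_diagram a)) :
  pure_composition a -> (x <= y)%O = (encoding a x \subset encoding a y).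
Proof.
move=> pa; apply/idP/idP => [|/encoding_sub le]; first exact: kposet_le_encoding.
apply/kposet_leP/(pure_reach pa); try exact: kposet_admissible.
exact/le/kposet_admissible.
Qed.

(** Minimality of [(c, v, t)] among the triples of [F] missing in [E] forces the count to be [v],
    the cell [(t, c)] to be present and [(t + 1, c)] to be free: otherwise a triple with value
    [v - 1] or level [t - 1] would be missing. Raising this cell adds exactly the triple. *)
Lemma unit_raise a E F c v t :
    admissible a E -> admissible a F ->
    (forall c' t', above E c' t' <= above F c' t') ->
    above E c t <= v < above F c t ->
    (forall c' v' t', above E c' t' <= v' < above F c' t' ->
       [\/ c < c', c = c' /\ v < v' | [/\ c = c', v = v' & t <= t']]) ->
  [/\ admissible a (move_cell E t c t.+1), above E c t = v &
      forall c' t', above (move_cell E t c t.+1) c' t' =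
                    above E c' t' + ((c' == c) && (t' == t))].
Proof.
move=> [pE totE leE colE] [_ totF leF colF] le /andP[le_v lt_v] minv.
have ev : above E c t = v.
  apply/eqP; rewrite eqn_leq le_v leqNgt; apply/negP => lt.
  by have [|||[]] := minv c v.-1 t; lia.
have t0 : 0 < t by case: posnP => // e; subst t; have := totE c; have := totF c; lia.
have up : (t.+1, c) \notin E.
  apply/negP => h; have := aboveS E c t; rewrite h.
  have := aboveS F c t; case: (_ \in F) => /= eF eE.
    by have [|||[]] := minv c v.-1 t.+1; lia.
  by have [|||[]] := minv c v.-1 t.+1; lia.
have tE : (t, c) \in E.
  apply/negPn/negP => h; have := aboveS E c t.-1; rewrite prednK // (negbTE h) => eE.
  have eF := aboveS F c t.-1; rewrite prednK // in eF.
  by have [|||[]] := minv c v t.-1; lia.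
have eG c' t' : above (move_cell E t c t.+1) c' t' = above E c' t' + ((c' == c) && (t' == t)).
  have := above_move_cell c' t' tE up; rewrite (eq_sym c').
  by case: (c == c'); rewrite ?andbF ?andbT //=; case: (ltngtP t' t) => h; lia.
split=> //; split=> [x|c'|c' t'|c' t' c'0].
- by rewrite in_move_cell => /predU1P[->//|/andP[_ /pE]].
- by rewrite eG (ltn_eqF t0) andbF addn0.
- apply: leq_trans (leF c' t'); rewrite eG; have := le c' t'.
  by case: eqP => [->|_]; case: eqP => [->|_] /=; lia.
rewrite !eG; have := colE c' t' c'0.
case: eqP => [ec|_]; case: eqP => [et|_] /=; rewrite ?andbF ?andbT; try lia.
(* The column inequality could only fail between [c] and its left neighbour [c']. Then [(c', v, t)]
   would be a smaller missing triple, as [F] satisfies the inequality. *)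
rewrite ec et (_ : c' == c = false); last by lia.
move=> _; rewrite addn0 addn1 ev ltnNge; apply/negP => le'.
have := colF c' t c'0; rewrite ec => leFc.
by have [|||[]] := minv c' v t; lia.
Qed.

Lemma pure_encoding_step a (x y : kohnert_poset (key_diagram a)) :
  pure_composition a -> (x < y)%O -> exists q (z : kohnert_poset (key_diagram a)),
  [/\ q \notin encoding a x, encoding a z = q |: encoding a x, (z <= y)%O &
      forall q', q' \in encoding a y -> q' \notin encoding a x -> (q <= q')%O].
Proof.
move=> pa lxy; have adx := kposet_admissible x; have ady := kposet_admissible y.
have /(encoding_sub y adx) le := kposet_le_encoding (ltW lxy).
have /subsetPn[q1 q1y q1x] : ~~ (encoding a y \subset encoding a x).
  by rewrite -pure_le_encoding // lt_geF.
pose new q := (q \in encoding a y) && (q \notin encoding a x).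
have q1P : new q1 by rewrite /new q1y q1x.
case: (@arg_minP _ _ _ q1 new id q1P) => -[c [v t]] /andP[qy qx] qmin.
have minv c' v' t' : above x c' t' <= v' < above y c' t' ->
    [\/ c < c', c = c' :> nat /\ v < v' | [/\ c = c' :> nat, v = v' :> nat & t <= t']].
  move=> /andP[le' lt']; have [hc hv ht] := admissible_bound ady lt'.
  have := qmin (Ordinal hc, (Ordinal hv, Ordinal ht)); rewrite /new !inE /= lt' -leqNgt le'.
  move=> /(_ isT); rewrite !lexi_pair !leEord /= => /andP[]; rewrite leq_eqVlt.
  case: ltngtP => //= [h _ _|e _]; first exact: Or31.
  case/andP; rewrite leq_eqVlt; case: ltngtP => //= [h _ _|e' _ lt]; first exact: Or32.
  exact: Or33.
rewrite !inE /= in qy qx; rewrite -leqNgt in qx.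
have [|adz ev eG] := unit_raise adx ady le _ minv; first by rewrite qx.
(* The raised diagram is admissible, hence pointwise below the key diagram and, by purity, reachable
   from it. *)
have rz := pure_reach pa adz (admissible_key a) (fun c t => (let: And4 _ _ h _ := adz in h) c t).
exists (c, (v, t)), (kposet_elt rz); split.
- by rewrite !inE /= ev ltnn.
- apply/setP => -[c' [v' t']]; rewrite !inE /= eG !xpair_eqE -!val_eqE /=.
  case: eqP => [->|_]; case: (eqVneq (t' : nat) t) => [->|_]; rewrite ?andbF ?andbT ?addn0 //=.
  by rewrite ev addn1 ltnS leq_eqVlt.
- rewrite pure_le_encoding //; apply/encoding_sub => // c' t' /=; rewrite eG.
  by have := le c' t'; case: eqP => [->|_]; case: eqP => [->|_] /=; lia.
- by move=> q' q'y q'x; apply: qmin; rewrite /new q'y q'x.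
Qed.

(** * Compositions that are not pure *)

Definition transpose_index i k := if k == i then i.+1 else if k == i.+1 then i else k.

Definition swap_parts i (b : seq nat) : seq nat :=
  mkseq (fun k => nth 0 b (transpose_index i k)) (size b).

Lemma transpose_indexK i : involutive (transpose_index i).
Proof.
move=> k; rewrite {2}/transpose_index.
by do 2?[case: ifP => ?]; rewrite /transpose_index; do 2?[case: ifP => ?]; lia.
Qed.

Lemma nth_swap_parts i b k :
  i.+1 < size b -> nth 0 (swap_parts i b) k = nth 0 b (transpose_index i k).
Proof.
move=> lti; have [le|lt] := leqP (size b) k; last by rewrite nth_mkseq.
rewrite nth_default ?size_mkseq // nth_default // /transpose_index.
by case: eqP => [|_]; [lia|case: eqP; lia].
Qed.

(** * Transposing an ascent by unit drops *)

Section Swap.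
Variables (i : nat) (b : seq nat).
Hypotheses (lti : i.+1 < size b) (asc : nth 0 b i < nth 0 b i.+1).

(* Interpolates between key_diagram b (u large) and key_diagram (swap_parts i b) (u = 0). *)
Definition mixed_diagram (u : nat) : diagram :=
  ([fset x in key_diagram b | x.2 <= u] `|`
   [fset x in key_diagram (swap_parts i b) | u < x.2])%fset.

Lemma in_mixed u r c : ((r, c) \in mixed_diagram u) =
  (0 < r) && (0 < c <= nth 0 b (if c <= u then r.-1 else transpose_index i r.-1)).
Proof.
have eb := in_key b r c; have es := in_key (swap_parts i b) r c.
rewrite /mixed_diagram; move: (key_diagram b) (key_diagram (swap_parts i b)) eb es => B S eb es.
rewrite !inE eb es nth_swap_parts //=.
by case: (leqP c u) => _; rewrite ?andbT ?andbF ?orbF.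
Qed.

(** Only column [u + 1] changes. If it lies beyond part [i] but within part [i + 1], its cell in row
    [i + 2] drops by one; it ends its row because the columns to the right are already swapped.
    Otherwise both rows agree there. *)
Lemma mixed_step u : mixed_diagram u = mixed_diagram u.+1 \/
  drops (mixed_diagram u.+1) i.+2 u.+1 i.+1 /\
  mixed_diagram u = move_cell (mixed_diagram u.+1) i.+2 u.+1 i.+1.
Proof.
case: (boolP (nth 0 b i < u.+1 <= nth 0 b i.+1)) => [/andP[lo hi]|out].
  right; split; last first.
    apply/fsetP => -[r c]; rewrite in_move_cell !in_mixed !xpair_eqE.
    case: (ltngtP c u.+1) => h; rewrite ?andbF ?andbT /=.
    - by have -> : c <= u by [].
    - by have -> : c <= u = false by lia.
    rewrite h ltnn /transpose_index.
    case: r => [|r] //=; rewrite !eqSS.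
    case: (eqVneq r i) => [->|_] /=; first by lia.
    by case: (eqVneq r i.+1) => [->|_] //=; lia.
  split=> [|c'||//|k]; try lia.
  - by rewrite in_mixed leqnn.
  - rewrite in_mixed /= /transpose_index; case: (leqP c' u.+1) => // lt.
    by rewrite (gtn_eqF (ltnSn i)) eqxx; lia.
  - by rewrite in_mixed leqnn /=; lia.
left; apply/fsetP => -[r c]; rewrite !in_mixed.
case: (ltngtP c u.+1) => h.
- by have -> : c <= u by [].
- by have -> : c <= u = false by lia.
rewrite h ltnn /transpose_index.
case: r => [|r] //=; case: (eqVneq r i) => [->|_] /=; first by lia.
by case: (eqVneq r i.+1) => [->|_] //=; lia.
Qed.

Lemma mixed0 : mixed_diagram 0 = key_diagram (swap_parts i b).
Proof.
apply/fsetP => -[r c]; rewrite in_mixed in_key nth_swap_parts //.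
by case: c => [|c] /=; rewrite ?andbF.
Qed.

Lemma mixed_large : mixed_diagram (sumn b) = key_diagram b.
Proof.
apply/fsetP => -[r c]; rewrite in_mixed in_key; case: (leqP c (sumn b)) => // lt.
have small k : nth 0 b k < c.
  apply: leq_ltn_trans lt; case: (posnP (nth 0 b k)) => [->//|pos].
  have : (k.+1, nth 0 b k) \in key_diagram b by rewrite in_key pos leqnn.
  by move/key_bound/andP => [].
by rewrite !(leqNgt c) !small !andbF.
Qed.

Lemma swap_parts_ind (P : diagram -> Prop) :
  (forall F r c, P F -> drops F r.+1 c r -> P (move_cell F r.+1 c r)) ->
  P (key_diagram b) -> P (key_diagram (swap_parts i b)).
Proof.
move=> step; rewrite -mixed0 -mixed_large; elim: (sumn b) => // u IH Pu.
by apply: IH; have [->|[dr ->]] := mixed_step u; last exact: step.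
Qed.

Lemma swap_parts_neq : key_diagram (swap_parts i b) <> key_diagram b.
Proof.
move=> /fsetP/(_ (i.+1, nth 0 b i.+1)); rewrite !in_key nth_swap_parts // /transpose_index /=.
by rewrite eqxx leqnn; lia.
Qed.

End Swap.

(** The end of row [r + 2] jumps over [(r + 1, c)] into [(r, c)], while the cell jumped over cannot
    move first, being blocked by [(r + 1, c')]. *)
Definition jump_config (x : diagram) r c c' : Prop :=
  [/\ (r.+2, c) \in x, forall k, (r.+2, k) \in x -> k <= c,
      ((r.+1, c) \in x) && ((r.+1, c') \in x), (r, c) \notin x & (0 < r) && (c < c')].

Lemma jump_config_drops x r c c' : jump_config x r c c' -> drops x r.+2 c r.
Proof.
move=> [rx rmax /andP[r1x _] nrx /andP[r0 _]]; split=> //; first by lia.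
by move=> k h; have -> : k = r.+1 by lia.
Qed.

Lemma jump_config_gap x r c c' z :
    jump_config x r c c' -> kohnert_reach x z ->
    (forall k t, above (move_cell x r.+2 c r) k t <= above z k t) ->
  z = x \/ kohnert_reach (move_cell x r.+2 c r) z.
Proof.
move=> cfg; have dr := jump_config_drops cfg.
have [rx rmax /andP[r1x r1x'] nrx /andP[r0 cc']] := cfg.
case/reach_first_move => [|[s [k [s' [ds rz]]]]] le; [by left|right].
have [sx smax /andP[s0 ss'] s'x _] := ds.
(* The first move towards [z] lowers column [k] at the levels from [s'] to [s - 1]. Above the jumped
   diagram there is room only in column [c] at levels [r] and [r + 1]. *)
have inside t : s' <= t < s -> c = k /\ r <= t < r.+2.
  move=> h; have := above_move_cell k t sx s'x; have := above_move_cell k t rx nrx.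
  have := above_reach k t rz; have := le k t.
  rewrite eqxx !andbT; case: eqP => [<-|_]; rewrite ?andbF ?andbT; last by lia.
  by move=> *; split=> //; lia.
have [ek hs'] : c = k /\ r <= s' < r.+2 by apply: inside; lia.
have [_ hs] : c = k /\ r <= s.-1 < r.+2 by apply: inside; lia.
subst k; have es' : s' = r.
  have : s' != r.+1 by apply: contraNneq s'x => ->.
  by lia.
have [es|es] : s = r.+1 \/ s = r.+2 by lia.
  by have := smax c'; rewrite es => /(_ r1x'); lia.
by rewrite -es -es'.
Qed.

(** * Chains of unit covers and the covers that skip a rank *)

Section UnitChains.
Variable a : seq nat.
Local Notation T := (kohnert_poset (key_diagram a)).
Local Notation rank := (fun x : T => #|encoding a x|).

(** A drop by one row lowers a single count by one, so it removes exactly one triple. *)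
Lemma unit_drop_cover (x : T) r c : drops x r.+1 c r ->
  exists2 y : T, kdiag y = move_cell x r.+1 c r & unit_cover rank y x.
Proof.
move=> dr; have rch := kohnert_reach_trans (kposet_reach x) (drops_reach dr).
exists (kposet_elt rch) => //; set y := kposet_elt rch.
have [rD _ _ r'D _] := dr.
have eA c' t : above x c' t = above y c' t + ((c == c') && (t == r)).
  have := above_move_cell c' t rD r'D; rewrite -/(kdiag y).
  by case: (c == c'); rewrite ?andbF ?andbT //=; case: (ltngtP t r) => h; lia.
have lt : above y c r < above x c r by rewrite eA !eqxx addn1.
have [hc hv ht] := admissible_bound (kposet_admissible x) lt.
have e : encoding a x = (Ordinal hc, (Ordinal hv, Ordinal ht)) |: encoding a y.
  apply/setP => -[c' [v' t']]; rewrite !inE /= eA !xpair_eqE -!val_eqE /=.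
  case: (eqVneq c c') => [<-|_]; case: (eqVneq (t' : nat) r) => [->|_];
    rewrite ?andbF ?andbT ?addn0 //=.
  by rewrite addn1 ltnS leq_eqVlt.
have card : #|encoding a x| = #|encoding a y|.+1 by rewrite e cardsU1 !inE /= ltnn.
rewrite /unit_cover card eqxx andbT lt_neqAle; apply/andP; split.
  by apply: contra_eq_neq card => ->; rewrite -[X in X != _]addn0 -addn1 eqn_add2l.
exact/kposet_leP/drops_reach.
Qed.

Lemma connect_unit_le x y : connect (unit_cover rank) x y -> (x <= y)%O.
Proof.
case/connectP => s p ->; elim: s x p => //= z s IH x /andP[/andP[lt _] /IH].
exact/le_trans/ltW.
Qed.

Lemma swap_connect (x : T) i b : i.+1 < size b -> nth 0 b i < nth 0 b i.+1 ->
    kdiag x = key_diagram b ->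
  exists2 y : T, kdiag y = key_diagram (swap_parts i b) & connect (unit_cover rank) y x.
Proof.
move=> lti asc ex.
apply: (swap_parts_ind lti asc (P := fun F => exists2 y : T, kdiag y = F & connect _ y x)).
  move=> F r c [y <- yx] dr; have [z ez zy] := unit_drop_cover dr.
  by exists z => //; apply: connect_trans (connect1 zy) yx.
by exists x; rewrite ?connect0.
Qed.

Lemma sorted_connect (x : T) b : kdiag x = key_diagram b ->
  exists y b', [/\ kdiag y = key_diagram b', forall i, nth 0 b' i.+1 <= nth 0 b' i &
    connect (unit_cover rank) y x].
Proof.
have [n] := ubnP (rank x); elim: n x b => // n IH x b lt_n ex.
have [[i asc]|nasc] := EM (exists i, nth 0 b i < nth 0 b i.+1); last first.
  exists x, b; split; rewrite ?connect0 // => i; rewrite leqNgt; apply/negP => lt.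
  by apply: nasc; exists i.
have lti : i.+1 < size b.
  by case: (ltnP i.+1 (size b)) => // /(nth_default 0) e; rewrite e in asc.
have [y ey yx] := swap_connect lti asc ex.
have lt : rank y < rank x.
  apply: kposet_encoding_lt; rewrite lt_neqAle connect_unit_le // andbT.
  by apply/eqP => e; case: (swap_parts_neq lti asc); rewrite -ey e.
have [|z [b' [ez sb zy]]] := IH y _ _ ey; first by lia.
by exists z, b'; split=> //; apply: connect_trans zy yx.
Qed.

(** When the rows weakly decrease, every column is justified to the bottom, which makes its counts
    the least possible for the given total. *)
Lemma sorted_above_min E b : admissible a E -> admissible a (key_diagram b) ->
    (forall i, nth 0 b i.+1 <= nth 0 b i) ->
  forall c t, above (key_diagram b) c t <= above E c t.
Proof.
move=> [_ totE _ _] [_ totb _ _] sb c t.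
have := above_leD E c 0 t; rewrite add0n totE -totb => leE.
case: (posnP (above (key_diagram b) c t)) => [->//|/above_pos[[i j]]].
rewrite in_key /= => /and3P[i0 j0 le] /andP[lti /eqP ej]; subst j.
have := @above_full (key_diagram b) c 0 t; rewrite add0n => e.
suff: above (key_diagram b) c 0 = above (key_diagram b) c t + t by lia.
apply: e => k /andP[k0 lek]; rewrite in_key k0 j0 (leq_trans le) //.
have /subnKC <- : k.-1 <= i.-1 by lia.
elim: (i.-1 - k.-1) => [|m IHm]; first by rewrite addn0.
by rewrite addnS (leq_trans (sb _)).
Qed.

(** Serves both directions: [bot] is the minimum in the pure case, and its unit path to the key
    diagram is the reference maximal chain in the converse. *)
Lemma sorted_bottom : exists bot : T,
  connect (unit_cover rank) bot (kposet_elt (kohnert_reach_refl _)) /\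
  forall (x : T) c t, above bot c t <= above x c t.
Proof.
have [bot [b [eb sb con]]] := @sorted_connect (kposet_elt (kohnert_reach_refl _)) a erefl.
exists bot; split=> // x c t; rewrite eb.
apply: sorted_above_min => //; first exact: kposet_admissible.
by rewrite -eb; exact: kposet_admissible.
Qed.

(** By [jump_config_gap] the jump is a cover, but it lowers the counts of column [c] at both levels
    [r] and [r + 1], so the encoding loses two triples. *)
Lemma jump_config_not_pure (x : T) r c c' : jump_config x r c c' -> ~ pure_poset T.
Proof.
move=> cfg pT; have dr := jump_config_drops cfg.
have rch := kohnert_reach_trans (kposet_reach x) (drops_reach dr).
pose y : T := kposet_elt rch.
have [rx rmax /andP[r1x r1x'] nrx /andP[r0 cc']] := cfg.
have eA k t : above y k t + ((t < r.+2) && (c == k)) = above x k t + ((t < r) && (c == k)).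
  exact: above_move_cell.
have lt0 : above y c r < above x c r by have := eA c r; rewrite ltnn eqxx; lia.
have lt1 : above y c r.+1 < above x c r.+1 by have := eA c r.+1; rewrite eqxx; lia.
have [bot [con min]] := sorted_bottom.
have bounds (z : T) : rank bot <= rank z <= rank (kposet_elt (kohnert_reach_refl _)).
  rewrite !subset_leq_card //; first exact/kposet_le_encoding/kposet_leP/kposet_reach.
  by apply/encoding_sub; first exact: kposet_admissible.
have lyx : (y < x)%O.
  rewrite lt_neqAle; apply/andP; split; last exact/kposet_leP/drops_reach.
  by apply: contraTneq lt0 => ->; rewrite ltnn.
have cov : covered_by y x.
  rewrite /covered_by lyx; apply/forallP => z; apply/negP => /andP[lyz lzx].
  have := jump_config_gap cfg (elimT (kposet_leP _ _) (ltW lzx)).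
  case=> [k t|e|zy].
  - exact: above_reach (elimT (kposet_leP _ _) (ltW lyz)).
  - by move: lzx; rewrite (val_inj e : z = x) ltxx.
  - by have := lt_le_trans lyz (introT (kposet_leP z y) zy); rewrite ltxx.
have rk := pure_poset_unit_covers (@kposet_encoding_lt a) bounds pT con cov.
have [hc hv ht] := admissible_bound (kposet_admissible x) lt0.
have [_ hv1 ht1] := admissible_bound (kposet_admissible x) lt1.
pose q0 := (Ordinal hc, (Ordinal hv, Ordinal ht)).
pose q1 := (Ordinal hc, (Ordinal hv1, Ordinal ht1)).
have q0x : q0 \in encoding a x by rewrite inE.
have q1x : q1 \in encoding a x by rewrite inE.
have : q0 |: (q1 |: encoding a y) \subset encoding a x.
  by rewrite !subUset !sub1set q0x q1x kposet_le_encoding // ltW.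
move/subset_leq_card; rewrite rk !cardsU1 !inE /= !ltnn !xpair_eqE -!val_eqE /=.
by rewrite (ltn_eqF (ltnSn r)) !andbF /= !add1n ltnn.
Qed.

End UnitChains.

(** The second and third forbidden patterns merged: in the second, the gap of two between the first
    and the middle part is automatic. *)
Definition pattern (b : seq nat) j1 j2 j3 : Prop :=
  [/\ j1 < j2, j2 < j3, j3 < size b &
    nth 0 b j1 < nth 0 b j2 < nth 0 b j3 \/
    nth 0 b j1 < nth 0 b j3 <= nth 0 b j2 /\ (nth 0 b j1).+1 < nth 0 b j2].

Lemma not_pure_pattern b : ~ pure_composition b -> exists j1 j2 j3, pattern b j1 j2 j3.
Proof.
move=> /contrapT[j1 [j2 [j3 [h12 h23 h3 h]]]]; exists j1, j2, j3; split=> //.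
by case: h => [h|h|/andP[h /eqP e]]; [left|right; lia|right; lia].
Qed.

Lemma pattern_not_pure b j1 j2 j3 : pattern b j1 j2 j3 -> ~ pure_composition b.
Proof.
move=> [h12 h23 h3 h]; apply; exists j1, j2, j3; split=> //=.
case: h => [h|[h h']]; first exact: Or31.
case: (ltngtP (nth 0 b j3) (nth 0 b j2)) => e; [apply: Or32|lia|apply: Or33]; lia.
Qed.

Lemma pattern_swap b i j1 j2 j3 :
    pattern b j1 j2 j3 -> i.+1 < size b ->
    transpose_index i j1 < transpose_index i j2 < transpose_index i j3 ->
  ~ pure_composition (swap_parts i b).
Proof.
move=> [h12 h23 h3 h] lti /andP[lt12 lt23].
apply: (@pattern_not_pure _ (transpose_index i j1) (transpose_index i j2) (transpose_index i j3)).
split; rewrite ?nth_swap_parts ?transpose_indexK // size_mkseq /transpose_index.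
by case: eqP => [|_]; [lia|case: eqP; lia].
Qed.

Lemma ascent_between (b : seq nat) j k : j < k -> nth 0 b j < nth 0 b k ->
  exists i, j <= i < k /\ nth 0 b i < nth 0 b i.+1.
Proof.
move=> /subnKC <-; elim: (k - j.+1) => [|n IH] lt; first by exists j; rewrite addn0 in lt *; split=> //; lia.
case: (ltnP (nth 0 b j) (nth 0 b (j.+1 + n))) => [/IH[i [hi asc]]|le].
  by exists i; split=> //; lia.
by exists (j.+1 + n); rewrite -addnS (leq_ltn_trans le) //; split=> //; lia.
Qed.

(** If [s < q], the end of the top row already jumps in the key diagram. If [s = q], the ends of the
    middle and top rows first drop by one row each; then the cell in column [q - 1] jumps, as
    [p < q - 1]. *)
Lemma jump_config_consecutive b j :
    j.+2 < size b -> nth 0 b j < nth 0 b j.+2 <= nth 0 b j.+1 ->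
    (nth 0 b j).+1 < nth 0 b j.+1 ->
  exists x r c c', kohnert_reach (key_diagram b) x /\ jump_config x r c c'.
Proof.
set p := nth 0 b j; set q := nth 0 b j.+1; set s := nth 0 b j.+2 => ltj /andP[ps sq] pq.
case: (ltngtP s q) sq => // h _.
  exists (key_diagram b), j.+1, s, q; split; first exact: kohnert_reach_refl.
  by split=> [|k||| //]; rewrite !in_key /= -/p -/q -/s; lia.
pose F := move_cell (key_diagram b) j.+2 q j.+1.
have inF r c : ((r, c) \in F) = ((r == j.+1) && (c == q)) ||
    ~~ ((r == j.+2) && (c == q)) && [&& 0 < r, 0 < c & c <= nth 0 b r.-1].
  by rewrite in_move_cell !xpair_eqE in_key.
have d1 : drops (key_diagram b) j.+2 q j.+1.
  by split=> [|k|||k]; rewrite ?in_key /= -?/p -?/q; lia.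
have d2 : drops F j.+3 q j.+2.
  by split=> [|k|||k]; rewrite ?inF /= -?/s -?/q; lia.
exists (move_cell F j.+3 q j.+2), j.+1, q.-1, q; split.
  exact: kohnert_reach_trans (drops_reach d1) (drops_reach d2).
by split=> [|k|||]; rewrite ?in_move_cell ?xpair_eqE ?in_key /= -?/p -?/q -?/s; lia.
Qed.

Lemma not_pure_jump_config D b :
    kohnert_reach D (key_diagram b) -> ~ pure_composition b ->
  exists x r c c', kohnert_reach D x /\ jump_config x r c c'.
Proof.
have [n] := ubnP (row_sum (key_diagram b)); elim: n b => // n IH b lt_n rb.
move=> /not_pure_pattern[j1 [j2 [j3 pat]]]; have [h12 h23 h3 h] := pat.
have swap i : i.+1 < size b -> nth 0 b i < nth 0 b i.+1 ->
    ~ pure_composition (swap_parts i b) ->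
    exists x r c c', kohnert_reach D x /\ jump_config x r c c'.
  move=> lti asc np.
  have rs : kohnert_reach (key_diagram b) (key_diagram (swap_parts i b)).
    apply: (swap_parts_ind lti asc); last exact: kohnert_reach_refl.
    by move=> F r c rF /drops_reach; exact: kohnert_reach_trans.
  apply: (IH (swap_parts i b)) => //; last exact: kohnert_reach_trans rs.
  by have [/(swap_parts_neq lti asc)//|lt] := kohnert_reach_row_sum rs; lia.
have lt12 : nth 0 b j1 < nth 0 b j2 by case: h; lia.
have [i [hi asc]] := ascent_between h12 lt12.
(* Unless [j1] and [j2] are adjacent, swapping an ascent between them preserves the order of the
   three positions, and so the pattern. *)
have [e|ne] := eqVneq j2 j1.+1; last first.
  apply: (swap i) => //; first lia.
  apply: (pattern_swap pat); first lia.
  by rewrite /transpose_index; do 6?[case: ifP => ?]; lia.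
subst j2.
have [lt23|le32] := ltnP (nth 0 b j1.+1) (nth 0 b j3).
  have [k [hk asck]] := ascent_between h23 lt23.
  apply: (swap k) => //; first lia.
  have [e|ne] := eqVneq j3 j1.+2.
    have ek : k = j1.+1 by lia.
    (* Three consecutive increasing parts: swapping the last two turns the first pattern into one of
       the merged kind. *)
    subst k j3; apply: (@pattern_not_pure _ j1 j1.+1 j1.+2); split; rewrite ?size_mkseq //.
    rewrite !nth_swap_parts // /transpose_index !eqxx.
    by right; do 4?[case: ifP => ?]; lia.
  apply: (pattern_swap pat); first lia.
  by rewrite /transpose_index; do 6?[case: ifP => ?]; lia.
have [[k [hk asck]]|nasc] := EM (exists k, j1.+1 <= k < j3 /\ nth 0 b k < nth 0 b k.+1).
  apply: (swap k) => //; first lia.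
  have nk : ~ (k = j1.+1 /\ j3 = j1.+2).
    by move=> [ek e3]; move: asck; rewrite ek -e3; lia.
  apply: (pattern_swap pat); first lia.
  by rewrite /transpose_index; do 6?[case: ifP => ?]; lia.
(* Without ascents the parts weakly decrease from [j1 + 1] to [j3], so [j1 + 2] can replace [j3] in
   the pattern. *)
have le1 : nth 0 b j1.+2 <= nth 0 b j1.+1.
  by rewrite leqNgt; apply/negP => lt; apply: nasc; exists j1.+1; split=> //; lia.
have le2 : nth 0 b j3 <= nth 0 b j1.+2.
  rewrite leqNgt; apply/negP => lt; have lt23 : j1.+2 < j3.
    by case: (ltngtP j1.+2 j3) => // [|e]; [lia|rewrite e ltnn in lt].
  have [k [hk asck]] := ascent_between lt23 lt.
  by apply: nasc; exists k; split=> //; lia.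
have [|||x [r [c [c' [rx cfg]]]]] := @jump_config_consecutive b j1.
- by lia.
- by case: h; lia.
- by case: h; lia.
by exists x, r, c, c'; split=> //; apply: kohnert_reach_trans rx.
Qed.

Lemma pure_poset_pure_composition a :
  pure_poset (kohnert_poset (key_diagram a)) -> pure_composition a.
Proof.
move=> pT; apply: contrapT => np.
have [x [r [c [c' [rx cfg]]]]] := not_pure_jump_config (kohnert_reach_refl _) np.
exact: (@jump_config_not_pure a (kposet_elt rx) r c c').
Qed.

Lemma pure_composition_shellable a : pure_composition a ->
  [/\ pure_poset (kohnert_poset (key_diagram a)),
      EL_shellable (kohnert_poset (key_diagram a)) &
      shellable_poset (kohnert_poset (key_diagram a))].
Proof.
move=> pa.
have le x y := @pure_le_encoding a x y pa.
have step x y := @pure_encoding_step a x y pa.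
have [bot [_ min]] := sorted_bottom a.
have bounds x : (bot <= x <= kposet_elt (kohnert_reach_refl (key_diagram a)))%O.
  apply/andP; split; last exact/kposet_leP/kposet_reach.
  by rewrite le; apply/encoding_sub => //; exact: kposet_admissible.
split.
- exact: (embedding_pure (triple0 a) le step bounds).
- exact: (embedding_EL_shellable (triple0 a) le step bounds).
- exact: (embedding_shellable (triple0 a) le step bounds).
Qed.

Theorem theorem5p8 (a : seq nat) :
  [<-> pure_poset (kohnert_poset (key_diagram a)) /\
         shellable_poset (kohnert_poset (key_diagram a));
       pure_poset (kohnert_poset (key_diagram a)) /\
         EL_shellable (kohnert_poset (key_diagram a));
       pure_composition a].
Proof.
tfae.
- by move=> [/pure_poset_pure_composition/pure_composition_shellable[]].
- by move=> [/pure_poset_pure_composition].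
- by move=> /pure_composition_shellable[].
Qed.
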